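(* Let $\mathbb{F}$ and $\mathbb{K}$ be fields with characteristics different from $2$. Let $n\ge 2$, $k\ge 1$, and let $\phi:M_n(\mathbb{F})^+\to M_k(\mathbb{K})^+$ be Jordan multiplicative. Then there exist nonnegative integers $s,r,u,t$ with $s+nr+nu+t=k$, an invertible matrix $S\in\mathrm{GL}_k(\mathbb{K})$, a unital ring homomorphism $\omega:\mathbb{F}\to M_r(\mathbb{K})$ if $r>0$, and a unital ring homomorphism $\sigma:\mathbb{F}\to M_u(\mathbb{K})$ if $u>0$, such that $$S\phi(X)S^{-1}=I_s\oplus\omega_n(X)\oplus\sigma_n(X^{\mathsf T})\oplus 0_t\qquad\text{for all } X\in M_n(\mathbb{F}),$$ where direct summands of size $0$ are omitted. Conversely, every map of this form is Jordan multiplicative. Moreover, $\phi(0)=0$ if and only if $s=0$, and $\phi$ is unital (i.e. $\phi(I_n)=I_k$) if and only if $t=0$.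
   Context: For a field $\mathbb{L}$ of characteristic different from $2$, $M_m(\mathbb{L})^+$ denotes the set of $m\times m$ matrices over $\mathbb{L}$ with the product $X\circ Y:=\frac12(XY+YX)$. A map $\phi:M_n(\mathbb{F})^+\to M_k(\mathbb{K})^+$ is Jordan multiplicative if $\phi(X\circ Y)=\phi(X)\circ\phi(Y)$ for all $X,Y$ (no additivity is assumed). For a unital ring homomorphism $\omega:\mathbb{F}\to M_r(\mathbb{K})$, its $n$-fold amplification $\omega_n:M_n(\mathbb{F})\to M_n(M_r(\mathbb{K}))\cong M_{nr}(\mathbb{K})$ is $\omega_n([x_{ij}]):=[\omega(x_{ij})]$ (block matrices); $\sigma_n$ is defined analogously. $X^{\mathsf T}$ is the transpose of $X$, $I_s$ the $s\times s$ identity matrix, $0_t$ the $t\times t$ zero matrix, and $\oplus$ denotes the block diagonal sum. *)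

(* Defs.v *)
From mathcomp Require Import all_boot all_order all_algebra.

Set Implicit Arguments.
Unset Strict Implicit.
Unset Printing Implicit Defensive.

Import GRing.Theory.
Local Open Scope ring_scope.

Definition jordan_mul (L : fieldType) (m : nat) (X Y : 'M[L]_m) : 'M[L]_m :=
  2%:R^-1 *: (X *m Y + Y *m X).

Definition jordan_multiplicative (F K : fieldType) (n k : nat)
    (phi : 'M[F]_n -> 'M[K]_k) : Prop :=
  forall X Y : 'M[F]_n, phi (jordan_mul X Y) = jordan_mul (phi X) (phi Y).

Lemma sum_const_ord (n r : nat) : (\sum_(i < n) r)%N = (n * r)%N.
Proof. by rewrite sum_nat_const card_ord. Qed.

(* The cast realises M_n(M_r(K)) = M_(n r)(K). *)
Definition amplification (F K : fieldType) (n r : nat)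
    (omega : F -> 'M[K]_r) (X : 'M[F]_n) : 'M[K]_(n * r) :=
  castmx (sum_const_ord n r, sum_const_ord n r)
    (\mxblock_(i < n, j < n) omega (X i j)).

Definition dsum_mx (K : fieldType) (p q : nat) (A : 'M[K]_p) (B : 'M[K]_q) :
    'M[K]_(p + q) :=
  block_mx A 0 0 B.

(* 'M[K]_0 is the zero ring, so for r = 0 (resp. u = 0) there is exactly one
   morphism omega (resp. sigma), and its summand is the empty block: the
   optional morphisms need no separate case. *)
Definition jordan_form (F K : fieldType) (n k s r u t : nat)
    (hk : (s + n * r + n * u + t)%N = k) (S : 'M[K]_k)
    (omega : {rmorphism F -> 'M[K]_r}) (sigma : {rmorphism F -> 'M[K]_u})
    (phi : 'M[F]_n -> 'M[K]_k) : Prop :=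
  forall X : 'M[F]_n,
    S *m phi X *m invmx S =
    castmx (hk, hk)
      (dsum_mx
        (dsum_mx
          (dsum_mx (1%:M : 'M[K]_s) (amplification omega X))
          (amplification sigma X^T))
        (0 : 'M[K]_t)).

(* Main.v *)
Require Import Defs.
From HB Require Import structures.
From mathcomp Require Import all_boot all_order all_algebra.
From mathcomp Require Import ring.

Set Implicit Arguments.
Unset Strict Implicit.
Unset Printing Implicit Defensive.

Import GRing.Theory.
Local Open Scope ring_scope.

(* Subtracting the idempotent phi(0) reduces to a map psi with psi(0) = 0, and
   the images p_i of the diagonal matrix units are orthogonal idempotents.
   Peirce components with respect to the p_i are images under Jordan
   multiplications, so they can be computed without additivity.  From this one
   gets first psi(1) = sum p_i, then psi(1 + t E_ab) = psi(1) + psi(t E_ab);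
   products of such unipotents give additivity of psi off the diagonal, hence
   everywhere.  For the additive map, p_o splits as alpha + beta with
   alpha = p_o psi(E_ol) psi(E_lo) and beta = p_o psi(E_lo) psi(E_ol)
   orthogonal idempotents; psi is multiplicative to the right of alpha and
   antimultiplicative to the right of beta, and alpha, beta are carried by the
   psi(E_io), psi(E_oi) to a resolution of psi(1).  Factoring phi(0), alpha,
   beta and 1 - phi(1) through their images gives the change of basis. *)

(** * Idempotents in rings without 2-torsion *)

Section TwoTorsionFree.

Variable A : pzRingType.
Hypothesis A2 : forall x : A, x + x = 0 -> x = 0.

Lemma addrr_inj (x y : A) : x + x = y + y -> x = y.
Proof.
move=> e; apply/eqP; rewrite -subr_eq0; apply/eqP/A2.
by rewrite addrACA e -opprD subrr.
Qed.

(** Multiplying by [p] on the left and on the right shows that [p * y] and [y * p] both equal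
    [- (p * y * p)]; their sum is 0, so twice each vanishes. *)
Lemma idem_jordan0 (p y : A) :
  p * p = p -> p * y + y * p = 0 -> p * y = 0 /\ y * p = 0.
Proof.
move=> pp e.
have e1 : p * y = - (p * y * p).
  apply/eqP; rewrite -addr_eq0; apply/eqP.
  by rewrite -{1}pp -!mulrA -mulrDr e mulr0.
have e2 : y * p = - (p * y * p).
  apply/eqP; rewrite -addr_eq0; apply/eqP.
  by rewrite -{1}pp addrC mulrA -mulrDl e mul0r.
have py : p * y = 0 by apply: A2; rewrite {2}e1 -e2.
by rewrite py; split=> //; move: e; rewrite py add0r.
Qed.

(** This is [idem_jordan0] for the complementary idempotent [1 - p]. *)
Lemma idem_jordan1 (p y : A) :
  p * p = p -> p * y + y * p = y + y -> p * y = y /\ y * p = y.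
Proof.
move=> pp e.
have [] := @idem_jordan0 (1 - p) y.
- by rewrite mulrBl mul1r mulrBr mulr1 pp subrr subr0.
- by rewrite mulrBl mul1r mulrBr mulr1 addrACA -opprD e subrr.
rewrite mulrBl mul1r mulrBr mulr1 => /eqP; rewrite subr_eq0 => /eqP <-.
by move=> /eqP; rewrite subr_eq0 => /eqP <-.
Qed.

Lemma idem_jordan_abs (p y w : A) : p * p = p -> p * y + y * p = w + w ->
  p * w = w -> w * p = w -> p * y = w /\ y * p = w.
Proof.
move=> pp e pw wp; have [] := @idem_jordan0 p (y - w) pp.
  by rewrite mulrBr mulrBl pw wp addrACA -opprD e subrr.
rewrite mulrBr mulrBl pw wp => /eqP; rewrite subr_eq0 => /eqP ->.
by move=> /eqP; rewrite subr_eq0 => /eqP ->.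
Qed.

(** The difference [q = p - v] is annihilated by [v] on both sides, so compressing the hypothesis by
    [q] gives 0 = 2 q p q = 2 q. *)
Lemma idem_jordan_inv (p v w : A) : p * p = p -> v * v = v ->
  p * v = v -> v * p = v -> v * w + w * v = p + p -> v = p.
Proof.
move=> pp vv pv vp h; apply/esym/eqP; rewrite -subr_eq0; apply/eqP/A2.
have [q qE] : exists q, q = p - v by exists (p - v).
have qv : q * v = 0 by rewrite qE mulrBl pv vv subrr.
have vq : v * q = 0 by rewrite qE mulrBr vp vv subrr.
have <- : q * p * q = p - v by rewrite {1}qE mulrBl pp vp -qE {2}qE mulrBr qv
  subr0 qE mulrBl pp vp.
rewrite -mulrDl -mulrDr -h mulrDr !mulrA qv mul0r add0r.
by rewrite -!mulrA vq !mulr0.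
Qed.

End TwoTorsionFree.

(** * Entrywise verification of identities between matrix units *)

Section MatrixUnits.

Variables (F : fieldType) (n : nat).
Implicit Types (X Y : 'M[F]_n) (i j : 'I_n).

Lemma mul_delta_mxE i j X x y : (delta_mx i j *m X) x y = (x == i)%:R * X j y.
Proof.
rewrite mxE (bigD1 j) //= mxE eqxx andbT big1 ?addr0 // => k kj.
by rewrite mxE (negbTE kj) andbF mul0r.
Qed.

Lemma mul_mx_deltaE i j X x y : (X *m delta_mx i j) x y = X x i * (y == j)%:R.
Proof.
rewrite mxE (bigD1 i) //= mxE eqxx andTb big1 ?addr0 // => k ki.
by rewrite mxE (negbTE ki) mulr0.
Qed.

Definition coord_proj (T : {set 'I_n}) : 'M[F]_n := diag_mx (\row_i (i \in
  T)%:R).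

Lemma mul_coord_projE T X x y : (coord_proj T *m X) x y = (x \in T)%:R * X x y.
Proof. by rewrite mul_diag_mx !mxE. Qed.

Lemma mul_mx_coord_projE T X x y : (X *m coord_proj T) x y =
  X x y * (y \in T)%:R.
Proof. by rewrite mul_mx_diag !mxE. Qed.

Lemma coord_projE T x y : coord_proj T x y = ((x \in T) && (x == y))%:R.
Proof. by rewrite !mxE; case: eqP; rewrite ?andbT ?andbF. Qed.

End MatrixUnits.

(** Restricted forms of [mxE], which would also unfold products into sums before matrix units can
    absorb them. *)
Lemma addmxE (F : fieldType) (m n : nat) (X Y : 'M[F]_(m, n)) x y :
  (X + Y) x y = X x y + Y x y.
Proof. by rewrite mxE. Qed.

Lemma scalemxE (F : fieldType) (m n : nat) (X : 'M[F]_(m, n)) a x y :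
  (a *: X) x y = a * X x y.
Proof. by rewrite mxE. Qed.

Lemma zeromxE (F : fieldType) (m n : nat) x y : @fun_of_matrix F m n 0 x y = 0.
Proof. by rewrite mxE. Qed.

Lemma deltaE (F : fieldType) (m n : nat) (i x : 'I_m) (j y : 'I_n) :
  @delta_mx F m n i j x y = ((x == i) && (y == j))%:R.
Proof. by rewrite mxE. Qed.

Lemma one_mxE (F : fieldType) n x y : @scalar_mx F n 1 x y = (x == y)%:R.
Proof. by rewrite mxE. Qed.

(** Evaluates the Kronecker deltas left by [entries], consulting the context before splitting cases;
    what remains is a goal for [ring]. *)
Ltac eq_cases :=
  repeat (first
   [ rewrite eqxx
   | match goal with
     | H : is_true (?u != ?v) |- context [?u == ?v] => rewrite (negbTE H)
     | H : is_true (?u != ?v) |- context [?v == ?u] =>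
         rewrite [v == u]eq_sym (negbTE H)
     | H : is_true (?u \notin ?v) |- context [?u \in ?v] => rewrite (negbTE H)
     | H : is_true (?u \in ?v) |- context [?u \in ?v] => rewrite H
     | |- context [?u == ?v] => case: (eqVneq u v) => [?|?]; [subst |]
     | |- context [?u \in ?v] => case: (boolP (u \in v)) => ?
     end ]);
  rewrite /=.

Ltac entries :=
  apply/matrixP => ? ?;
  repeat progress (rewrite ?(mulmxDl, mulmxDr, mulmx1, mul1mx, mulmx0, mul0mx);
    rewrite -?(scalemxAl, scalemxAr));
  rewrite ?(addmxE, scalemxE, zeromxE);
  rewrite ?(mul_delta_mxE, mul_mx_deltaE, mul_coord_projE, mul_mx_coord_projE);
  rewrite ?(addmxE, scalemxE, zeromxE, coord_projE, deltaE, one_mxE).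

(** * Additivity *)

(** The Jordan identity is doubled so that the target ring needs no element 1/2, only the absence of
    2-torsion. *)
Definition preJordan (F : fieldType) (n : nat) (A : pzRingType)
    (psi : 'M[F]_n -> A) : Prop :=
  [/\ forall x : A, x + x = 0 -> x = 0, psi 0 = 0 &
      forall X Y, psi (jordan_mul X Y) *+ 2 = psi X * psi Y + psi Y * psi X].

Section Jordan.

Variables (F : fieldType) (n : nat) (A : pzRingType) (psi : 'M[F]_n -> A).
Hypothesis F2 : 2%:R != 0 :> F.
Hypothesis psiP : preJordan psi.
Implicit Types (X Y Z W : 'M[F]_n) (i j k : 'I_n) (s t : F).

Let A2 : forall x : A, x + x = 0 -> x = 0. Proof. by case: psiP. Qed.
Let psi0 : psi 0 = 0. Proof. by case: psiP. Qed.

Lemma invr2D : 2%:R^-1 + 2%:R^-1 = 1 :> F.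
Proof. by rewrite -[2%:R^-1]mul1r -mulrDl mulfV. Qed.

Lemma scale_halfD (X : 'M[F]_n) : 2%:R^-1 *: X + 2%:R^-1 *: X = X.
Proof. by rewrite -scalerDl invr2D scale1r. Qed.

(** Working form of the Jordan identity: the Jordan product is supplied as a candidate [Z] and
    checked entrywise. *)
Lemma psiJ X Y Z : X *m Y + Y *m X = Z + Z ->
  psi X * psi Y + psi Y * psi X = psi Z + psi Z.
Proof.
case: psiP => _ _ h e; rewrite -h /jordan_mul e scalerDr scale_halfD.
by rewrite mulr2n.
Qed.

Notation E := (@delta_mx F n n).
Notation p i := (psi (E i i)).

Lemma idem_img Z : Z *m Z = Z -> psi Z * psi Z = psi Z.
Proof. by move=> ZZ; apply: (addrr_inj A2); rewrite (@psiJ _ _ Z) ?ZZ. Qed.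

Lemma unit_idem i : p i * p i = p i.
Proof. by apply: idem_img; rewrite mul_delta_mx. Qed.

Lemma unit_orth i j : i != j -> p i * p j = 0.
Proof.
move=> ij; have [] // := @idem_jordan0 _ A2 (p i) (p j) (unit_idem i).
rewrite (@psiJ _ _ 0) ?psi0 ?addr0 //.
by rewrite !mul_delta_mx_cond [j == i]eq_sym (negbTE ij) addr0.
Qed.

Notation e := (psi 1%:M).

Let ee : e * e = e. Proof. by apply: idem_img; rewrite mulmx1. Qed.

Let e_absorb X : e * psi X = psi X /\ psi X * e = psi X.
Proof. by apply: idem_jordan1 => //; apply: psiJ; rewrite mul1mx mulmx1. Qed.
Lemma unit_mull X : e * psi X = psi X. Proof. by have [] := e_absorb X. Qed.
Lemma unit_mulr X : psi X * e = psi X. Proof. by have [] := e_absorb X. Qed.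

(* For i <> j this says that Z is supported on the entries (i,j) and (j,i). *)
Definition off i j (Z : 'M[F]_n) :=
  E i i *m Z + Z *m E i i = Z /\ E j j *m Z + Z *m E j j = Z.

Lemma offC i j Z : off i j Z -> off j i Z.
Proof. by case. Qed.

Lemma offD i j Z W : off i j Z -> off i j W -> off i j (Z + W).
Proof. by move=> [a b] [c d]; split;
  rewrite mulmxDr mulmxDl addrACA ?a ?c ?b ?d. Qed.

Lemma offZ i j a Z : off i j Z -> off i j (a *: Z).
Proof. by move=> [u v]; split; rewrite -scalemxAr -scalemxAl -scalerDr ?u ?v.
  Qed.

Lemma off_delta i j : i != j -> off i j (E i j).
Proof.
move=> ij; split; rewrite !mul_delta_mx_cond !eqxx [j == i]eq_sym (negbTE ij)
  /= ?addr0 //.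
by rewrite mulr0n mulr1n add0r.
Qed.

Lemma off_pair i j s t : i != j -> off i j (s *: E i j + t *: E j i).
Proof.
move=> ij; apply: offD; apply: offZ; first exact: off_delta.
by apply: offC; apply: off_delta; rewrite eq_sym.
Qed.

(* Compare the Peirce components of w = psi(2Z) relative to p_i and p_j: both
   Jordan products of w with p_i and p_j equal 2 psi(Z). *)
Let off_peirce i j Z : i != j -> off i j Z ->
  [/\ p i * psi Z = psi Z * p j, p j * psi Z = psi Z * p i &
      psi Z = p i * psi Z + p j * psi Z].
Proof.
move=> ij oZ; have [oi oj] := oZ; set x := psi Z; set w := psi (Z + Z).
have ji : j != i by rewrite eq_sym.
have wi : p i * w + w * p i = x + x.
  by apply: psiJ; rewrite mulmxDr mulmxDl addrACA oi.
have wj : p j * w + w * p j = x + x.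
  by apply: psiJ; rewrite mulmxDr mulmxDl addrACA oj.
(* Multiplying by [p a] on both sides kills the right-hand side, so [p a * w * p a = 0]; multiplying
   on one side only then leaves the mixed corners. *)
have key a b : a != b -> p a * w + w * p a = p b * w + w * p b ->
    p a * w = p a * w * p b /\ w * p a = p b * w * p a.
  move=> ab h.
  have h1 : p a * w + p a * w * p a = p a * w * p b.
    have := congr1 (fun z => p a * z) h.
    by rewrite !mulrDr !mulrA unit_idem (unit_orth ab) mul0r add0r.
  have h2 : p a * w * p a + w * p a = p b * w * p a.
    have := congr1 (fun z => z * p a) h; rewrite !mulrDl -!mulrA unit_idem.
    by rewrite [p b * p a]unit_orth ?mulr0 ?addr0 // eq_sym.
  have h3 : p a * w * p a = 0.
    apply: A2; have := congr1 (fun z => z * p a) h1.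
    by rewrite mulrDl -!mulrA unit_idem [p b * p a]unit_orth ?mulr0 // eq_sym.
  by rewrite -h1 -h2 h3 addr0 add0r.
have wij : p i * w + w * p i = p j * w + w * p j by rewrite wi wj.
have [a1 a2] := key _ _ ij wij.
have [b1 b2] := key _ _ ji (esym wij).
have q1 : p i * x + p i * x = p i * w * p j.
  rewrite -mulrDr -wi mulrDr mulrA unit_idem a2 !mulrA unit_orth // !mul0r
    addr0; exact: a1.
have q2 : x * p j + x * p j = p i * w * p j.
  by rewrite -mulrDl -wj mulrDl -[w * p j * p j]mulrA unit_idem b1 -!mulrA
    unit_orth // !mulr0 add0r mulrA -b2.
have q3 : p j * x + p j * x = p j * w * p i.
  rewrite -mulrDr -wj mulrDr mulrA unit_idem b2 !mulrA unit_orth // !mul0r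
    addr0; exact: b1.
have q4 : x * p i + x * p i = p j * w * p i.
  by rewrite -mulrDl -wi mulrDl -[w * p i * p i]mulrA unit_idem a1 -!mulrA
    unit_orth // !mulr0 add0r mulrA -a2.
split; try apply: (addrr_inj A2); rewrite ?q1 ?q2 ?q3 ?q4 //.
by rewrite addrACA q1 q3 -wi -a1 -a2.
Qed.

Lemma off_comm i j Z : i != j -> off i j Z -> p i * psi Z = psi Z * p j.
Proof. by move=> ij o; have [] := off_peirce ij o. Qed.
Lemma off_sum i j Z : i != j -> off i j Z -> psi Z = p i * psi Z + p j * psi Z.
Proof. by move=> ij o; have [] := off_peirce ij o. Qed.

(** With w = psi(2Z), w = p_i w + p_j w = p_i w + w p_i, which is the Jordan product coming from
    E_ii and 2Z. *)
Lemma off_double i j Z : i != j -> off i j Z -> psi (Z + Z) = psi Z + psi Z.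
Proof.
move=> ij oZ; have o2 := offD oZ oZ.
have ji : j != i by rewrite eq_sym.
rewrite (off_sum ij o2) (off_comm ji (offC o2)).
by apply: psiJ; case: oZ => oi _; rewrite mulmxDr mulmxDl addrACA oi.
Qed.

Lemma off_orth i j k Z : i != j -> off i j Z -> k != i -> k != j ->
  p k * psi Z = 0 /\ psi Z * p k = 0.
Proof.
move=> ij oZ ki kj; split; rewrite (off_sum ij oZ) ?mulrDr ?mulrDl ?mulrA.
  by rewrite !unit_orth // !mul0r addr0.
rewrite (off_comm ij oZ) (off_comm _ (offC oZ)) 1?eq_sym // -!mulrA.
by rewrite !unit_orth ?mulr0 ?addr0 // eq_sym.
Qed.

Lemma off_diag0 i j k Z : i != j -> off i j Z -> p k * psi Z * p k = 0.
Proof.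
move=> ij oZ; have [->|ki] := eqVneq k i.
  by rewrite (off_comm ij oZ) -mulrA unit_orth ?mulr0 // eq_sym.
have [->|kj] := eqVneq k j.
  by rewrite (off_comm _ (offC oZ)) 1?eq_sym // -mulrA unit_orth ?mulr0.
by have [-> _] := off_orth ij oZ ki kj; rewrite mul0r.
Qed.

(** * Vanishing of the idempotent psi(1) - sum p_i *)

Section Remainder.

Variable r : A.
Hypothesis rp : forall k, r * p k = 0 /\ p k * r = 0.
Hypothesis er : e = r + \sum_i p i.

Let N X := r * psi X = 0 /\ psi X * r = 0.

(** Multiplying the Jordan products with the [p i] by [r] kills the corners between [r] and [p i];
    by [er] these corners and [r * psi X * r] make up [r * psi X] and [psi X * r]. *)
Let N_crit X (w : 'I_n -> 'M[F]_n) : r * psi X * r = 0 ->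
  (forall i, E i i *m X + X *m E i i = w i + w i) -> (forall i, N (w i)) -> N X.
Proof.
move=> rXr wi Nw.
have h i : p i * psi X + psi X * p i = psi (w i) + psi (w i) by apply: psiJ.
have h1 i : r * psi X * p i = 0.
  have := congr1 (fun z => r * z) (h i).
  by rewrite !mulrDr !mulrA (rp i).1 mul0r add0r (Nw i).1 addr0.
have h2 i : p i * psi X * r = 0.
  have := congr1 (fun z => z * r) (h i).
  by rewrite !mulrDl -!mulrA (rp i).2 mulr0 addr0 (Nw i).2 addr0.
split.
  by rewrite -(unit_mulr X) er mulrDr mulrDr !mulrA rXr add0r mulr_sumr;
    apply: big1 => i _; apply: h1.
rewrite -(unit_mull X) er mulrDl mulrDl rXr add0r !mulr_suml;
  apply: big1 => i _; apply: h2.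
Qed.

(** A Jordan product with one factor in [N] loses its [r]-corner; [N_crit] then upgrades this to
    [N]. *)
Let N_jord X Y Z : N X -> X *m Y + Y *m X = Z + Z -> r * psi Z * r = 0.
Proof.
move=> [N1 N2] h; apply: A2; have := congr1 (fun z => r * z * r) (psiJ h).
rewrite !mulrDr !mulrDl !mulrA N1 !mul0r add0r => <-.
by rewrite -mulrA N2 mulr0.
Qed.

Let N_off i j Z : i != j -> off i j Z -> N Z.
Proof.
move=> ij oZ; split; rewrite (off_sum ij oZ).
  by rewrite mulrDr !mulrA !(rp _).1 !mul0r addr0.
rewrite (off_comm ij oZ) (off_comm _ (offC oZ)) 1?eq_sym // mulrDl -!mulrA.
by rewrite !(rp _).2 !mulr0 addr0.
Qed.

Let N0 : N 0. Proof. by split; rewrite psi0 ?mulr0 ?mul0r. Qed.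

(* For T = S + {a, b}: c = e_S + 2 E_ab is the Jordan product of e_S + E_aa and
   e_S + 4 E_ab, and e_T is the Jordan product of c and e_S + E_ba. *)
Let N_coord_proj T : N (coord_proj F T).
Proof.
have [m] := ubnP #|T|; elim: m T => // m IH T Tm.
have [->|[a aT]] := set_0Vmem T.
  rewrite (_ : coord_proj F set0 = 0); first exact: N0.
  by entries; rewrite inE.
have [Ta|[b]] := set_0Vmem (T :\ a).
  have -> : coord_proj F T = E a a.
    apply/matrixP=> x y; rewrite coord_projE deltaE.
    by rewrite -(setD1K aT) Ta !inE orbF; case: eqP => // ->; rewrite eq_sym.
  by case: (rp a).
rewrite !inE => /andP[ba bT]; pose S := T :\ a :\ b.
have cT : #|T| = #|S|.+2.
  by rewrite (cardsD1 a) aT (cardsD1 b (T :\ a)) !inE ba bT.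
have aS : a \notin S by rewrite !inE eqxx andbF.
have bS : b \notin S by rewrite !inE eqxx.
have ab : a != b by rewrite eq_sym.
have TS : coord_proj F T = coord_proj F S + E a a + E b b.
  by entries; rewrite !inE; eq_cases; ring.
have NX : N (coord_proj F S + E a a).
  have -> : coord_proj F S + E a a = coord_proj F (a |: S).
    by entries; rewrite !inE; eq_cases; ring.
  by apply: IH; rewrite cardsU1 aS -ltnS -cT.
(* The Jordan product of this matrix with E_ii is E_ii for i in S, E_ab for i = a or i = b, and 0
   otherwise. *)
have Nc : N (coord_proj F S + 2%:R *: E a b).
  apply: (@N_crit _ (fun i => if i \in S then E i i else
      if (i == a) || (i == b) then E a b else 0)).
  - apply: (@N_jord _ (coord_proj F S + 4%:R *: E a b) _ NX).
    by entries; eq_cases; ring.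
  - move=> i; case: (boolP (i \in S)) => iS; last case: ifP => [/orP[]/eqP ->|].
    + have ia : i != a by apply: contraNneq aS => <-.
      have ib : i != b by apply: contraNneq bS => <-.
      by entries; eq_cases; ring.
    + by entries; eq_cases; ring.
    + by entries; eq_cases; ring.
    + by move=> /negbT/norP[ia ib]; entries; eq_cases; ring.
  - move=> i; case: ifP => iS; first by case: (rp i).
    case: ifP => _; last exact: N0.
    exact: (N_off ab (off_delta ab)).
apply: (@N_crit _ (fun i => if i \in T then E i i else 0)).
- apply: (@N_jord _ (coord_proj F S + E b a) _ Nc).
  by rewrite TS; entries; eq_cases; ring.
- by move=> i; case: (boolP (i \in T)) => iT; entries; eq_cases; ring.
- by move=> i; case: ifP => _; [case: (rp i) | exact: N0].
Qed.

(** For T the set of all indices, [N_coord_proj] gives [e * r = 0], whereas [e] acts as the identity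
    on r = e - sum p_i. *)
Lemma remainder0 : r = 0.
Proof.
have cT : coord_proj F setT = 1%:M :> 'M_n.
  by apply/matrixP=> x y; rewrite coord_projE one_mxE inE.
have re : e * r = r.
  apply: (addIr (\sum_i p i)); rewrite -er -[RHS]ee {2}[in RHS]er mulrDr.
  by rewrite mulr_sumr; congr (_ + _); apply: eq_bigr => i _; rewrite unit_mull.
have [_] := N_coord_proj setT; rewrite cT re //.
Qed.

End Remainder.

Lemma sum_p : \sum_i p i = e.
Proof.
apply/esym/eqP; rewrite -subr_eq0; apply/eqP/remainder0; last by rewrite subrK.
move=> k; rewrite mulrBr mulrBl unit_mull unit_mulr mulr_suml mulr_sumr (bigD1
  k) //= unit_idem.
rewrite big1 ?addr0 => [|i ik]; last by rewrite unit_orth.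
rewrite (bigD1 k) //= unit_idem big1 ?addr0 ?subrr // => i ik.
by rewrite unit_orth // eq_sym.
Qed.

(** Jordan multiplication by E_ii and then by E_jj leaves a quarter of the entries (i,j) and (j,i)
    of X; two uses of [off_double] restore the factor 4. *)
Lemma peirce_off i j X : i != j -> p i * psi X * p j + p j * psi X * p i =
  psi (X i j *: E i j + X j i *: E j i).
Proof.
move=> ij; have ji : j != i by rewrite eq_sym.
pose Y := 2%:R^-1 *: (E i i *m X + X *m E i i).
pose Z := X i j *: E i j + X j i *: E j i.
have oZ : off i j Z by apply: off_pair.
pose W := 2%:R^-1 *: Z.
have h1 : p i * psi X + psi X * p i = psi Y + psi Y.
  by apply: psiJ; rewrite scale_halfD.
have h2 : p j * psi Y + psi Y * p j = psi (2%:R^-1 *: W) + psi (2%:R^-1 *: W).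
  by apply: psiJ; rewrite scale_halfD /W /Y /Z; entries; eq_cases; ring.
have psiZ : psi Z = psi W + psi W.
  by rewrite -(off_double ij) ?scale_halfD //; apply: offZ.
have psiW : psi W = psi (2%:R^-1 *: W) + psi (2%:R^-1 *: W).
  by rewrite -(off_double ij) ?scale_halfD //; do 2!apply: offZ.
rewrite -/Z psiZ psiW -h2 addrACA -mulrDr -mulrDl -h1 mulrDr mulrDl !mulrA.
by rewrite unit_orth // mul0r add0r -[_ * p i * p j]mulrA unit_orth // mulr0
  addr0 addrC.
Qed.

(** A left factor [p i] separates the two corners in [peirce_off]. Both entries enter because psi
    may mix a matrix with its transpose. *)
Lemma peirce_congr i j X Y : i != j -> X i j = Y i j -> X j i = Y j i ->
  p i * psi X * p j = p i * psi Y * p j.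
Proof.
move=> ij h1 h2; have h := peirce_off X ij.
rewrite h1 h2 -(peirce_off Y ij) in h.
have := congr1 (fun z => p i * z) h.
by rewrite !mulrDr !mulrA unit_idem unit_orth // !mul0r !addr0.
Qed.

Lemma peirce_row i u : u * e = u ->
  p i * u = p i * u * p i + \sum_(j | j != i) p i * u * p j.
Proof.
by move=> ue; rewrite -{1}ue -sum_p mulrA mulr_sumr (bigD1 i).
Qed.

Lemma peirce_col i u : e * u = u ->
  u * p i = p i * u * p i + \sum_(j | j != i) p j * u * p i.
Proof.
by move=> eu; rewrite -{1}eu -sum_p mulr_suml mulr_suml (bigD1 i).
Qed.

Lemma peirce_ext u v : e * u * e = u -> e * v * e = v ->
  (forall i j, p i * u * p j = p i * v * p j) -> u = v.
Proof.
move=> hu hv h; rewrite -hu -hv -sum_p !mulr_suml; apply: eq_bigr => i _.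
by rewrite !mulr_sumr; apply: eq_bigr => j _; apply: h.
Qed.

(** * Values at the unipotents 1 + t E_ab *)

Section Unipotent.

Variables a b : 'I_n.
Hypothesis ab : a != b.

Notation x t := (psi (t *: E a b)).
Notation y t := (psi (1%:M + t *: E a b)).

Let ox t : off a b (t *: E a b). Proof. by apply/offZ/off_delta. Qed.

(** Off the diagonal, 1 + t E_ab and t E_ab have the same entries, hence the same corners; only the
    diagonal corners of [y t] remain unknown. *)
Let y_row i t : p i * y t = p i * y t * p i + p i * x t.
Proof.
rewrite (peirce_row i (unit_mulr (t *: E a b))) {1}(peirce_row i (unit_mulr
  (1%:M + t *: E a b))).
rewrite (off_diag0 i ab (ox t)) add0r; congr (_ + _).
apply: eq_bigr => j ji; apply: peirce_congr; first by rewrite eq_sym.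
  by rewrite addmxE one_mxE eq_sym (negbTE ji) add0r.
by rewrite addmxE one_mxE (negbTE ji) add0r.
Qed.

Let y_col i t : y t * p i = p i * y t * p i + x t * p i.
Proof.
rewrite (peirce_col i (unit_mull (t *: E a b))) (peirce_col i (unit_mull (1%:M
  + t *: E a b))).
rewrite (off_diag0 i ab (ox t)) add0r; congr (_ + _).
apply: eq_bigr => j ji; apply: peirce_congr => //.
  by rewrite addmxE one_mxE (negbTE ji) add0r.
by rewrite addmxE one_mxE eq_sym (negbTE ji) add0r.
Qed.

Notation z t i := (p i * y t * p i).

Let xx0 s t : x s * x t + x t * x s = 0.
Proof.
rewrite (@psiJ _ _ 0) ?psi0 ?addr0 //.
by entries; eq_cases; ring.
Qed.

Let z_mul s t i : p i * y s * y t * p i = z s i * z t i + p i * x s * x t * p i.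
Proof.
rewrite {1}y_row mulrDl mulrDl; congr (_ + _).
  by rewrite !mulrA -[_ * p i * p i]mulrA unit_idem.
rewrite -[LHS]mulrA y_col mulrDr !mulrA (off_diag0 i ab (ox s)) !mul0r add0r //.
Qed.

(** The product of 1 + s E_ab and 1 + t E_ab is 1 + (s + t) E_ab; in the diagonal corner the
    contributions of [x s] and [x t] cancel by [xx0]. *)
Let z_jordan s t i : z s i * z t i + z t i * z s i = z (s + t) i + z (s + t) i.
Proof.
have h : y s * y t + y t * y s = y (s + t) + y (s + t).
  by apply: psiJ; entries; eq_cases; ring.
have q := congr1 (fun w => p i * w * p i) (xx0 s t).
rewrite mulrDr mulrDl !mulrA mulr0 mul0r in q.
have := congr1 (fun w => p i * w * p i) h.
by rewrite !mulrDr !mulrDl !mulrA !z_mul addrACA q addr0 => <-; rewrite !mulrA.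
Qed.

(* Jordan multiplication by E_ii halves the off-diagonal part, so the diagonal
   component of psi(1 + s E_ab) does not depend on the scale of s. *)
Let z_half s i : z (s + s) i = z s i.
Proof.
(* [V] is the Jordan product of E_ii with 1 + 2s E_ab, and [W] that of E_ii both with [V] and with 1
   + s E_ab; each such product preserves the (i,i) corner of the image. *)
pose V := if (i == a) || (i == b) then E i i + s *: E a b else E i i.
pose W := 2%:R^-1 *: (E i i *m (1%:M + s *: E a b) + (1%:M + s *: E a b) *m E i
  i).
have h1 : p i * y (s + s) + y (s + s) * p i = psi V + psi V.
  apply: psiJ; rewrite /V.
  by case: eqVneq => [->|ia]; last case: eqVneq => [->|ib];
     entries; eq_cases; ring.
have h2 : p i * psi V + psi V * p i = psi W + psi W.
  apply: psiJ; rewrite scale_halfD /V.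
  by case: eqVneq => [->|ia]; last case: eqVneq => [->|ib];
     entries; eq_cases; ring.
have h3 : p i * y s + y s * p i = psi W + psi W by apply: psiJ;
  rewrite scale_halfD.
have comp u v : p i * u + u * p i = v + v -> p i * u * p i = p i * v * p i.
  move=> h; apply: (addrr_inj A2); have := congr1 (fun w => p i * w * p i) h.
  by rewrite !mulrDr !mulrDl !mulrA unit_idem -!mulrA unit_idem.
by rewrite (comp _ _ h1) (comp _ _ h2) (comp _ _ h3).
Qed.

(** By [z_jordan] and [z_half] the diagonal corners are idempotents below [p i]; those at s and -s
    have Jordan product [p i], so [idem_jordan_inv] makes them equal to [p i]. *)
Lemma psi_unipotent t : y t = e + x t.
Proof.
have z1 s i : z s i = p i.
  have zz r : z r i * z r i = z r i.
    by apply: (addrr_inj A2); rewrite z_jordan z_half.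
  have pz r : p i * z r i = z r i /\ z r i * p i = z r i.
    by rewrite !mulrA unit_idem -!mulrA unit_idem.
  have := z_jordan s (- s) i; rewrite subrr scale0r addr0 unit_mulr unit_idem.
  by apply: (idem_jordan_inv A2 (unit_idem i)); rewrite ?zz ?(pz s).1 ?(pz s).2.
apply: peirce_ext; first by rewrite unit_mull unit_mulr.
  by rewrite mulrDr mulrDl !unit_mull !unit_mulr.
move=> i j; rewrite mulrDr mulrDl unit_mulr.
have [->|ij] := eqVneq i j.
  by rewrite z1 unit_idem (off_diag0 j ab (ox t)) addr0.
rewrite unit_orth // add0r; apply: peirce_congr => //.
  by rewrite addmxE one_mxE (negbTE ij) add0r.
by rewrite addmxE one_mxE eq_sym (negbTE ij) add0r.
Qed.

(** Expand the Jordan product of the unipotents 1 + s E_ab and 1 + t E_ab; the cross terms cancel by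
    [xx0]. *)
Lemma psi_lineD s t : x (s + t) = x s + x t.
Proof.
have h : y s * y t + y t * y s = y (s + t) + y (s + t).
  by apply: psiJ; entries; eq_cases; ring.
rewrite !psi_unipotent in h.
apply: (addrI e); apply: (addrr_inj A2); rewrite -h.
have mulU u v : u * e = u -> e * v = v ->
    (e + u) * (e + v) = e + (u + v) + u * v.
  by move=> ue ev; rewrite mulrDr !mulrDl ee ue ev !addrA.
rewrite !mulU ?unit_mull ?unit_mulr // [x t + _]addrC.
by rewrite [RHS]addrACA [LHS]addrACA xx0 addr0 addrACA.
Qed.

End Unipotent.

Lemma off_corner a b Z : a != b -> off a b Z ->
  p a * psi Z * p b + p b * psi Z * p a = psi Z.
Proof.
move=> ab oZ; have ba : b != a by rewrite eq_sym.
rewrite [RHS](off_sum ab oZ) -!mulrA -(off_comm ab oZ) -(off_comm ba (offC oZ)).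
by rewrite !mulrA !unit_idem.
Qed.

(** [X] is the Jordan product of 1 + s E_ab and 1 + t E_ba. Its mixed corners give the left side by
    [peirce_off], and expanding the two unipotent values gives the right side. *)
Lemma psi_pair a b s t : a != b ->
  psi (s *: E a b + t *: E b a) = psi (s *: E a b) + psi (t *: E b a).
Proof.
move=> ab; have ba : b != a by rewrite eq_sym.
have -> : s = 2%:R^-1 * s + 2%:R^-1 * s.
  by rewrite -mulrDl invr2D mul1r.
set r := _ * s.
have ox : off a b ((r + r) *: E a b) by apply/offZ/off_delta.
have oy : off a b (t *: E b a) by apply/offC/offZ/off_delta.
pose X := 1%:M + ((r + r) *: E a b + t *: E b a) + (r * t) *: (E a a + E b b).
have h : psi (1%:M + (r + r) *: E a b) * psi (1%:M + t *: E b a) +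
     psi (1%:M + t *: E b a) * psi (1%:M + (r + r) *: E a b) = psi X + psi X.
  by apply: psiJ; rewrite /X; entries; eq_cases; ring.
rewrite !psi_unipotent // in h.
have q := peirce_off X ab.
have Xab : X a b = r + r by rewrite /X !(addmxE, scalemxE, deltaE, one_mxE);
  eq_cases; ring.
have Xba : X b a = t by rewrite /X !(addmxE, scalemxE, deltaE, one_mxE);
  eq_cases; ring.
rewrite Xab Xba in q; rewrite -q; apply: (addrr_inj A2).
rewrite [LHS](_ : _ = p a * (psi X + psi X) * p b + p b * (psi X + psi X) * p
  a); last first.
  by rewrite !mulrDr !mulrDl addrACA.
rewrite -h.
move: (off_corner ab ox) (off_corner ab oy) (off_comm ab ox) (off_comm ab oy)
  (off_comm ba (offC ox)) (off_comm ba (offC oy)) (off_diag0 a ab ox)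
    (off_diag0 a ab oy)
  (off_diag0 b ab ox) (off_diag0 b ab oy) (unit_mull ((r + r) *: E a b))
    (unit_mulr ((r + r) *: E a b))
  (unit_mull (t *: E b a)) (unit_mulr (t *: E b a)).
move: (psi ((r + r) *: E a b)) (psi (t *: E b a)) => x y.
move=> cx cy x1 y1 x2 y2 xa ya xb yb ex xe ey ye.
have mulU u v : u * e = u -> e * v = v ->
    (e + u) * (e + v) = e + (u + v) + u * v.
  by move=> ue ev; rewrite mulrDr !mulrDl ee ue ev !addrA.
have -> : (e + x) * (e + y) + (e + y) * (e + x) =
    e + e + (x + y + (x + y)) + (x * y + y * x).
  by rewrite !mulU // [y + x]addrC addrACA [X in X + _]addrACA.
have p0 c c' : c != c' -> p c * (e + e + (x + y + (x + y)) + (x * y + y * x)) *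
  p c' =
    p c * x * p c' + p c * x * p c' + (p c * y * p c' + p c * y * p c') +
    p c * (x * y + y * x) * p c'.
  move=> cc; rewrite !(mulrDr, mulrDl) unit_mulr unit_orth // !add0r.
  by congr (_ + _); rewrite addrACA.
rewrite !p0 //.
(* The products [x * y] and [y * x] contribute nothing to the mixed corners. *)
have xy0 : p a * (x * y) * p b = 0
  by rewrite mulrA x1 -!mulrA [p b * _]mulrA yb mulr0.
have yx0 : p a * (y * x) * p b = 0
  by rewrite mulrA y1 -!mulrA [p b * _]mulrA xb mulr0.
have xy1 : p b * (x * y) * p a = 0
  by rewrite mulrA x2 -!mulrA [p a * _]mulrA ya mulr0.
have yx1 : p b * (y * x) * p a = 0
  by rewrite mulrA y2 -!mulrA [p a * _]mulrA xa mulr0.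
rewrite !mulrDr !mulrDl xy0 yx0 xy1 yx1 !addr0.
by rewrite addrACA [X in X + _ = _]addrACA [X in _ + X =
  _]addrACA cx cy addrACA.
Qed.

(** * Diagonal corners and full additivity *)

Notation d i s := (psi (s *: E i i)).

Lemma diag_absorb i s : p i * d i s = d i s /\ d i s * p i = d i s.
Proof. by apply: (idem_jordan1 A2 (unit_idem i)); apply: psiJ; entries;
  eq_cases; ring. Qed.

(** Jordan multiplication by E_ii yields s E_ii for i = a or i = b and 0 otherwise; [sum_p] adds the
    pieces. *)
Lemma psi_scale_diag2 a b s : a != b ->
  psi (s *: (E a a + E b b)) = d a s + d b s.
Proof.
move=> ab; set y := psi _.
pose w i : 'M[F]_n := if (i == a) || (i == b) then s *: E i i else 0.
have h i : p i * y = psi (w i).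
  have [] // := @idem_jordan_abs _ A2 (p i) y (psi (w i));
    rewrite ?unit_idem //.
  - by apply: psiJ; rewrite /w; case: eqVneq => [->|ia];
    last case: eqVneq => [->|ib];
     entries; eq_cases; ring.
  - by rewrite /w; case: ifP => _;
    [case: (diag_absorb i s) | rewrite psi0 mulr0].
  - by rewrite /w; case: ifP => _;
    [case: (diag_absorb i s) | rewrite psi0 mul0r].
rewrite -[LHS]unit_mull -sum_p mulr_suml (bigD1 a) //= (bigD1 b) 1?eq_sym //=
  !h /w !eqxx orbT /=.
rewrite big1 ?addr0 // => i /andP[/negbTE ia /negbTE ib].
by rewrite -/y h /w ia ib psi0.
Qed.

Lemma psi_off_mul a b s t : a != b ->
  psi (s *: E a b) * psi (t *: E b a) + psi (t *: E b a) * psi (s *: E a b) =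
  d a (s * t) + d b (s * t).
Proof.
move=> ab; have ba : b != a by rewrite eq_sym.
apply: (addrr_inj A2); rewrite -psi_scale_diag2 //.
have := @psiJ (s *: E a b) ((t + t) *: E b a) ((s * t) *: (E a a + E b b)).
move=> <-; last by entries; eq_cases; ring.
by rewrite psi_lineD // mulrDr mulrDl addrACA.
Qed.

Hypothesis n2 : (1 < n)%N.

Let neq i : exists j, j != i.
Proof.
have n0 : (0 < n)%N by apply: ltnW.
have [->|h] := eqVneq i (Ordinal n0); first by exists (Ordinal n2).
by exists (Ordinal n0); rewrite eq_sym.
Qed.

(** By [psi_off_mul], [d i r] is the [p i] part of the Jordan product of psi(r E_ij) with psi(E_ji),
    and psi(r E_ij) is additive in r. *)
Lemma psi_diagD i s t : d i (s + t) = d i s + d i t.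
Proof.
have [j ji] := neq i; have ij : i != j by rewrite eq_sym.
have h r : p i * (psi (r *: E i j) * psi (1 *: E j i) + psi (1 *: E j i) * psi
  (r *: E i j)) = d i r.
  rewrite psi_off_mul // mulr1 mulrDr (diag_absorb i r).1 -(diag_absorb j r).1
    mulrA.
  by rewrite unit_orth // mul0r addr0.
rewrite -!h -mulrDr; congr (_ * _).
by rewrite psi_lineD // mulrDl mulrDr addrACA.
Qed.

(** [X'] keeps the (i,i) corner and has zero (j,j) corner. Jordan multiplication by Z = E_ij + E_ji
    moves the (i,i) corner to (i,j), where [peirce_congr] compares it with that of X_ii E_ii; since
    psi(Z)^2 = p_i + p_j, the move can be undone. *)
Lemma peirce_diag i X : p i * psi X * p i = d i (X i i).
Proof.
have [j ji] := neq i; have ij : i != j by rewrite eq_sym.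
pose X' := 2%:R^-1 *: (E i i *m X + X *m E i i).
set y := psi X'.
have hy : p i * psi X + psi X * p i = y + y by apply: psiJ; rewrite scale_halfD.
have yi : p i * y * p i = p i * psi X * p i.
  apply: (addrr_inj A2); have := congr1 (fun w => p i * w * p i) hy.
  by rewrite !mulrDr !mulrDl !mulrA unit_idem -!mulrA unit_idem.
have yj : p j * y * p j = 0.
  apply: A2; have := congr1 (fun w => p j * w * p j) hy.
  by rewrite !mulrDr !mulrDl !mulrA unit_orth // !mul0r add0r -!mulrA unit_orth
    // !mulr0.
pose Z := E i j + E j i; set z := psi Z.
have oZ : off i j Z by apply: offD; [exact: off_delta | apply/offC/off_delta].
have zz : z * z = p i + p j.
  have h := @psi_scale_diag2 i j 1 ij; rewrite !scale1r in h.
  by rewrite -h; apply: (addrr_inj A2); apply: psiJ; rewrite /Z; entries;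
    eq_cases; ring.
have X'i : X' i i = X i i.
  rewrite /X' !(addmxE, scalemxE, mul_delta_mxE, mul_mx_deltaE) eqxx mul1r
    mulr1.
  by rewrite mulrDr -mulrDl invr2D mul1r.
have X'j : X' j j = 0.
  by rewrite /X' !(addmxE, scalemxE, mul_delta_mxE, mul_mx_deltaE) (negbTE ji)
    mul0r mulr0 addr0 mulr0.
clearbody X'; pose C := X i i *: E i i.
have cmp : p i * (y * z + z * y) * p j =
  p i * (d i (X i i) * z + z * d i (X i i)) * p j.
  have h1 : y * z + z * y = psi (2%:R^-1 *: (X' *m Z + Z *m X')) *+ 2.
    by rewrite mulr2n; apply: psiJ; rewrite scale_halfD.
  have h2 : d i (X i i) * z + z * d i (X i i) =
    psi (2%:R^-1 *: (C *m Z + Z *m C)) *+ 2.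
    by rewrite mulr2n; apply: psiJ; rewrite scale_halfD.
  (* At (i,j) and at (j,i) this is half of M_ii + M_jj, which is X_ii / 2 for both [X'] and [C]. *)
  have entry u v M : (2%:R^-1 *: (M *m Z + Z *m M)) u v =
      2%:R^-1 * ((v == j)%:R * M u i + (v == i)%:R * M u j +
                 ((u == i)%:R * M j v + (u == j)%:R * M i v)).
    rewrite /Z ?(mulmxDl, mulmxDr) !(addmxE, scalemxE, mul_delta_mxE,
      mul_mx_deltaE).
    by rewrite [(v == j)%:R * _]mulrC [(v == i)%:R * _]mulrC.
  rewrite h1 h2 !mulr2n !mulrDr !mulrDl.
  rewrite (@peirce_congr i j _ (2%:R^-1 *: (C *m Z + Z *m C)) ij) //.
    by rewrite !entry /C !(scalemxE, deltaE) X'i X'j; eq_cases; ring.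
  by rewrite !entry /C !(scalemxE, deltaE) X'i X'j; eq_cases; ring.
have zj : z * p j = p i * z by rewrite (off_comm ij oZ).
have comp u : p j * u * p j = 0 ->
    p i * (u * z + z * u) * p j = p i * u * p i * z.
  move=> uj; rewrite mulrDr mulrDl.
  have -> : p i * (u * z) * p j = p i * u * p i * z by rewrite -!mulrA zj.
  have -> : p i * (z * u) * p j = z * (p j * u * p j) by rewrite !mulrA -zj.
  by rewrite uj mulr0 addr0.
have [pd dp] := diag_absorb i (X i i).
move: cmp; rewrite comp // comp; last by rewrite -pd mulrA unit_orth // !mul0r.
move=> cmp; have := congr1 (fun w => w * z) cmp.
rewrite yi pd dp -!mulrA zz !mulrDr unit_idem dp -{2}dp -!mulrA unit_orth //
  !mulr0 !addr0.
exact.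
Qed.

(** Corner by corner: [psi_diagD] handles the diagonal, [psi_pair] and [psi_lineD] the rest. *)
Lemma psiD X Y : psi (X + Y) = psi X + psi Y.
Proof.
apply: peirce_ext; first by rewrite unit_mull unit_mulr.
  by rewrite mulrDr mulrDl !unit_mull !unit_mulr.
move=> i j; rewrite mulrDr mulrDl.
have [->|ij] := eqVneq i j.
  by rewrite !peirce_diag addmxE psi_diagD.
pose Z X := X i j *: E i j + X j i *: E j i.
have hZ V : p i * psi V * p j = p i * psi (Z V) * p j.
  by apply: peirce_congr => //; rewrite /Z !(addmxE, scalemxE, deltaE);
    eq_cases; ring.
rewrite (hZ (X + Y)) (hZ X) (hZ Y) -mulrDl -mulrDr; congr (_ * _ * _);
  rewrite /Z !psi_pair // !addmxE.
have ji : j != i by rewrite eq_sym.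
by rewrite (psi_lineD ij) (psi_lineD ji) addrACA.
Qed.

End Jordan.

(** * The multiplicative corner *)

Section Homomorphic.

Variables (F : fieldType) (n : nat) (A : pzRingType) (psi : 'M[F]_n -> A).
Hypothesis F2 : 2%:R != 0 :> F.
Hypothesis psiP : preJordan psi.
Variables o l : 'I_n.
Hypothesis ol : o != l.
Implicit Types (X Y Z W : 'M[F]_n) (i j k : 'I_n) (s t : F).

Notation E := (@delta_mx F n n).
Notation p i := (psi (E i i)).
Notation d s := (psi (s *: E o o)).

Let A2 : forall x : A, x + x = 0 -> x = 0. Proof. by case: psiP. Qed.
Let psi0 : psi 0 = 0. Proof. by case: psiP. Qed.
Let n2 : (1 < n)%N.
Proof.
case: n o l ol => [[]//|[|//]] x y; by rewrite !ord1.
Qed.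
Let pp := unit_idem F2 psiP.
Let pq := unit_orth F2 psiP.
Let D := psiD F2 psiP n2.

Lemma jordan_add X Y : psi X * psi Y + psi Y * psi X = psi (X *m Y + Y *m X).
Proof.
rewrite (@psiJ _ _ _ _ F2 psiP _ _ (2%:R^-1 *: (X *m Y + Y *m X))).
  by rewrite -D (scale_halfD F2).
by rewrite (scale_halfD F2).
Qed.

Lemma psi_sum I (r : seq I) (P : pred I) f :
  psi (\sum_(i <- r | P i) f i) = \sum_(i <- r | P i) psi (f i).
Proof. by apply: (big_morph psi); [exact: D | exact: psi0]. Qed.

Notation u := (psi (E o l)).
Notation v := (psi (E l o)).

(** This is [p o] for multiplicative psi and 0 for antimultiplicative psi. It is locked so that
    rewriting treats it as one factor. *)
Definition hom_proj := locked (p o * u * v).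
Notation alpha := hom_proj.

Lemma hom_projE : alpha = p o * u * v. Proof. by rewrite /hom_proj -lock. Qed.

Let lo : l != o. Proof. by rewrite eq_sym. Qed.

Let offZ_delta i j s : i != j -> off i j (s *: E i j).
Proof. by move=> ij; apply/offZ/off_delta. Qed.

Let oc i j s : i != j -> p i * psi (s *: E i j) = psi (s *: E i j) * p j.
Proof. by move=> ij; apply: (off_comm F2 psiP ij); apply: offZ_delta. Qed.

Let oc' i j s : i != j -> p j * psi (s *: E i j) = psi (s *: E i j) * p i.
Proof.
move=> ij; have ji : j != i by rewrite eq_sym.
by apply: (off_comm F2 psiP ji); apply/offC/offZ_delta.
Qed.

Let Pu : p o * u = u * p l. Proof. by have := oc 1 ol; rewrite !scale1r. Qed.
Let lv : p l * v = v * p o. Proof. by have := oc 1 lo; rewrite !scale1r. Qed.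

Let sq0 i j : i != j -> psi (E i j) * psi (E i j) = 0.
Proof.
move=> ij; apply: A2; rewrite jordan_add mul_delta_mx_cond.
by rewrite eq_sym (negbTE ij) addr0 psi0.
Qed.

Let Pd s : p o * d s = d s. Proof. by have [] := diag_absorb F2 psiP o s. Qed.
Let dP s : d s * p o = d s. Proof. by have [] := diag_absorb F2 psiP o s. Qed.
Let kd k s : k != o -> p k * d s = 0.
Proof. by move=> ko; rewrite -Pd mulrA pq // mul0r. Qed.
Let dk k s : k != o -> d s * p k = 0.
Proof. by move=> ko; rewrite -dP -mulrA pq ?mulr0 // eq_sym. Qed.

Lemma hom_projP : alpha * p o = alpha.
Proof. by rewrite hom_projE -mulrA -lv mulrA -[_ * p l]mulrA -Pu mulrA pp. Qed.

Lemma P_hom_proj : p o * alpha = alpha.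
Proof. by rewrite hom_projE !mulrA pp. Qed.

Lemma hom_proj_lo : alpha * v = 0.
Proof. by rewrite hom_projE -mulrA sq0 // mulr0. Qed.

(** Here and in the next three lemmas, the matrix is the sum of the two products of s E_oo with a
    matrix unit; multiplying by [p o] kills one of the two image terms, since [d s] is orthogonal to
    [p k]. *)
Let Px k s : k != o -> p o * psi (s *: E o k) = d s * psi (E o k).
Proof.
move=> ko; have ok : o != k by rewrite eq_sym.
have -> : psi (s *: E o k) = d s * psi (E o k) + psi (E o k) * d s.
  by rewrite jordan_add; congr psi; entries; eq_cases; ring.
have h := oc 1 ok; rewrite !scale1r in h.
by rewrite mulrDr !mulrA Pd h -[_ * p k * _]mulrA kd // mulr0 addr0.
Qed.

Let xP k s : k != o -> psi (s *: E o k) * p o = psi (E o k) * d s.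
Proof.
move=> ko; have ok : o != k by rewrite eq_sym.
have -> : psi (s *: E o k) = d s * psi (E o k) + psi (E o k) * d s.
  by rewrite jordan_add; congr psi; entries; eq_cases; ring.
have h := oc' 1 ok; rewrite !scale1r in h.
by rewrite mulrDl -[d s * _ * _]mulrA -h mulrA dk // mul0r add0r -mulrA dP.
Qed.

Let Py k s : k != o -> p o * psi (s *: E k o) = d s * psi (E k o).
Proof.
move=> ko; have ok : o != k by rewrite eq_sym.
have -> : psi (s *: E k o) = d s * psi (E k o) + psi (E k o) * d s.
  by rewrite jordan_add; congr psi; entries; eq_cases; ring.
have h := oc' 1 ko; rewrite !scale1r in h.
by rewrite mulrDr !mulrA Pd h -[_ * p k * _]mulrA kd // mulr0 addr0.
Qed.

Let yP k s : k != o -> psi (s *: E k o) * p o = psi (E k o) * d s.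
Proof.
move=> ko; have ok : o != k by rewrite eq_sym.
have -> : psi (s *: E k o) = d s * psi (E k o) + psi (E k o) * d s.
  by rewrite jordan_add; congr psi; entries; eq_cases; ring.
have h := oc 1 ko; rewrite !scale1r in h.
by rewrite mulrDl -[d s * _ * _]mulrA -h mulrA dk // mul0r add0r -mulrA dP.
Qed.

(** Passing through [u] turns [d s] into psi(s E_ll), and passing through [v] turns it back. *)
Lemma hom_proj_comm s : d s * alpha = alpha * d s.
Proof.
pose dl' := psi (s *: E l l).
have h1 : psi (s *: E o l) = u * dl' + dl' * u.
  by rewrite jordan_add; congr psi; entries; eq_cases; ring.
have h2 : psi (s *: E l o) = dl' * v + v * dl'.
  by rewrite jordan_add; congr psi; entries; eq_cases; ring.
have [pd dp] := diag_absorb F2 psiP l s; rewrite -/dl' in pd dp.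
have Pdl : p o * dl' = 0 by rewrite -pd mulrA pq // mul0r.
have dlP : dl' * p o = 0 by rewrite -dp -mulrA pq // mulr0.
have h3 : d s * u = u * dl'.
  by rewrite -Px // h1 mulrDr !mulrA Pdl mul0r addr0 Pu -mulrA pd.
have h4 : v * d s = dl' * v.
  by rewrite -yP // h2 mulrDl -!mulrA dlP mulr0 addr0 -lv mulrA dp.
by rewrite hom_projE !mulrA dP h3 -[_ * v * d s]mulrA h4 mulrA Pu -[u * p l *
  _]mulrA pd.
Qed.

(** All cases reduce to [alpha * v = 0]: for k = l by commuting [d t] past [alpha], otherwise by
    writing E_ko through E_kl and E_lo. *)
Lemma hom_proj_col k t : k != o -> alpha * psi (t *: E k o) = 0.
Proof.
move=> ko; have [->|kl] := eqVneq k l.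
  by rewrite -hom_projP -mulrA Py // mulrA -hom_proj_comm -mulrA hom_proj_lo
    mulr0.
have -> : psi (t *: E k o) = psi (t *: E k l) * v + v * psi (t *: E k l).
  by rewrite jordan_add; congr psi; entries; eq_cases; ring.
rewrite mulrDr !mulrA hom_proj_lo mul0r addr0 -hom_projP -[_ * p o * _]mulrA.
have ok : o != k by rewrite eq_sym.
by have [-> _] := off_orth F2 psiP kl (offZ_delta t kl) ok ol;
  rewrite mulr0 mul0r.
Qed.

(** Thus [alpha] sees only row o: with that row zero, each corner (o,k) of psi(Y) comes from column
    o alone, which [hom_proj_col] kills. *)
Lemma hom_proj_row0 Y : (forall j, Y o j = 0) -> alpha * psi Y = 0.
Proof.
move=> Y0; rewrite -(unit_mulr F2 psiP Y) -(sum_p F2 psiP) !mulr_sumr big1 //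
  => k _.
rewrite -hom_projP !mulrA.
have [->|ko] := eqVneq k o.
  by rewrite -[_ * p o * psi Y]mulrA -mulrA (peirce_diag F2 psiP n2) Y0 scale0r
    psi0 mulr0.
have ok : o != k by rewrite eq_sym.
rewrite -[_ * p o * psi Y]mulrA -mulrA (@peirce_congr _ _ _ _ F2 psiP _ _ Y (Y
  k o *: E k o) ok).
- by rewrite !mulrA hom_projP hom_proj_col // mul0r.
- by rewrite Y0 !(scalemxE, deltaE); eq_cases; ring.
- by rewrite !(scalemxE, deltaE); eq_cases; ring.
Qed.

(** Under [alpha] only psi(s E_ol) psi(t E_lo) = d(s t) survives of [psi_off_mul]; the scalar s is
    then pulled out as [d s], which commutes with [alpha]. *)
Lemma hom_proj_diagM s t : alpha * d s * d t = alpha * d (s * t).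
Proof.
have h r : alpha * (psi (r *: E o l) * psi (t *: E l o)) = alpha * d (r * t).
  have := psi_off_mul F2 psiP r t ol.
  move/(congr1 (fun z => alpha * z));
    rewrite !mulrDr [alpha * (psi (t *: _) * _)]mulrA.
  rewrite hom_proj_col // mul0r addr0 => ->.
  by rewrite [X in _ + X]hom_proj_row0 ?addr0 // => j;
    rewrite !(scalemxE, deltaE); eq_cases; ring.
have h1 : alpha * (u * psi (t *: E l o)) = alpha * d t.
  by have := h 1; rewrite scale1r mul1r.
have -> : alpha * d (s * t) = d s * (alpha * (u * psi (t *: E l o))).
  rewrite -(h s) [RHS]mulrA hom_proj_comm -[RHS]mulrA [d s * _]mulrA -Px //
    -{1}hom_projP.
  by rewrite -!mulrA.
by rewrite h1 [RHS]mulrA hom_proj_comm.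
Qed.

Let elem k m r x : alpha * psi (r *: E o k) * psi (x *: E o m) =
  alpha * psi (r *: E o k *m (x *: E o m)).
Proof.
have [->|ko] := eqVneq k o.
  have -> : r *: E o o *m (x *: E o m) = (r * x) *: E o m by entries;
    eq_cases; ring.
  have [->|mo] := eqVneq m o; first exact: hom_proj_diagM.
  have om : o != m by rewrite eq_sym.
  have -> : psi ((r * x) *: E o m) =
    d r * psi (x *: E o m) + psi (x *: E o m) * d r.
    by rewrite jordan_add; congr psi; entries; eq_cases; ring.
  rewrite mulrDr [X in _ + X](_ : _ = 0) ?addr0 ?mulrA //.
  by rewrite -hom_projP -[_ * p o * _]mulrA oc // -mulrA -mulrA -Pd [p m *
    _]mulrA pq // mul0r !mulr0.
have ok : o != k by rewrite eq_sym.
have -> : r *: E o k *m (x *: E o m) = 0 by entries; eq_cases; ring.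
rewrite psi0 mulr0.
have -> : alpha * psi (r *: E o k) = alpha * (d r * psi (E o k)) * p k.
  have h := oc 1 ok; rewrite !scale1r in h.
  by rewrite -{1}hom_projP -[LHS]mulrA Px // -[RHS]mulrA -[d r * _ * _]mulrA -h
    [d r * (_ * _)]mulrA dP.
have [->|mk] := eqVneq m k.
  by rewrite -[LHS]mulrA oc' // xP // -!mulrA [psi (E o k) * (_ * _)]mulrA sq0
    // mul0r !mulr0.
have [->|mo] := eqVneq m o.
  by rewrite -[LHS]mulrA kd // mulr0.
have om : o != m by rewrite eq_sym.
have km : k != m by rewrite eq_sym.
by rewrite -mulrA; have [-> _] := off_orth F2 psiP om (offZ_delta x om) ko km;
  rewrite mulr0.
Qed.

(** Split Y into its row o, handled by [elem], and a rest Z. For Z the Jordan identity suffices,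
    since [alpha] kills both psi(Z) and psi(Z X). *)
Lemma hom_proj_mul X Y : (forall i j, i != o -> X i j = 0) ->
  alpha * psi X * psi Y = alpha * psi (X *m Y).
Proof.
move=> X0.
have XE : X = \sum_k X o k *: E o k.
  apply/matrixP => i j; rewrite summxE (bigD1 j) //= big1 => [|k kj].
    rewrite !(scalemxE, deltaE); have [->|io] := eqVneq i o; rewrite eqxx /=.
      by rewrite mulr1 addr0.
    by rewrite (X0 i j io) mulr0 addr0.
  by rewrite !(scalemxE, deltaE); eq_cases; ring.
pose Y1 := \sum_k Y o k *: E o k.
have Y2 : forall j, (Y - Y1) o j = 0.
  move=> j; rewrite !mxE summxE (bigD1 j) //= big1 => [|k kj].
    by rewrite !(scalemxE, deltaE); eq_cases; ring.
  by rewrite !(scalemxE, deltaE); eq_cases; ring.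
have -> : Y = Y1 + (Y - Y1) by rewrite addrC subrK.
move: (Y - Y1) Y2 => Z Z0.
rewrite D mulmxDr D !mulrDr; congr (_ + _).
  rewrite /Y1 XE mulmx_suml !psi_sum [alpha * _]mulr_sumr mulr_suml
    [RHS]mulr_sumr; apply: eq_bigr => k _.
  by rewrite mulmx_sumr psi_sum !mulr_sumr; apply: eq_bigr => m _; rewrite elem.
have := jordan_add X Z; rewrite D => /(congr1 (fun z => alpha * z)).
rewrite !mulrDr [alpha * (psi Z * _)]mulrA hom_proj_row0 // mul0r addr0 mulrA
  => ->.
rewrite [X in _ + X]hom_proj_row0 ?addr0 // => j.
by rewrite mxE big1 // => k _; rewrite Z0 mul0r.
Qed.

End Homomorphic.

Lemma trmx_jordan_mul (F : fieldType) n (X Y : 'M[F]_n) :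
  (jordan_mul X Y)^T = jordan_mul X^T Y^T.
Proof. by rewrite /jordan_mul linearZ /= linearD /= !trmx_mul addrC. Qed.

(** * Splitting into multiplicative and antimultiplicative parts *)

Section Splitting.

Variables (F : fieldType) (n : nat) (A : pzRingType).
Hypothesis F2 : 2%:R != 0 :> F.
Variables o l : 'I_n.
Hypothesis ol : o != l.
Implicit Types (X Y Z W : 'M[F]_n) (i j k : 'I_n) (s t : F).

Notation E := (@delta_mx F n n).

(** Transposition preserves Jordan products, so results on [alpha] transfer to the
    antimultiplicative part [beta]. *)
Lemma preJordan_tr (psi phi : 'M[F]_n -> A) :
  (forall X, phi X = psi X^T) -> preJordan psi -> preJordan phi.
Proof.
move=> phiT [h1 h2 h3]; split=> //; first by rewrite phiT trmx0.
by move=> X Y; rewrite !phiT -h3 trmx_jordan_mul.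
Qed.

Section OneSided.

Variables psi phi : 'M[F]_n -> A.
Hypothesis psiP : preJordan psi.
Hypothesis phiT : forall X, phi X = psi X^T.

Let phiP : preJordan phi := preJordan_tr phiT psiP.

Notation alpha := (hom_proj psi o l).
Notation beta := (hom_proj phi o l).
Notation p i := (psi (E i i)).
Notation d s := (psi (s *: E o o)).

Let phi_delta i j : phi (E i j) = psi (E j i).
Proof. by rewrite phiT trmx_delta. Qed.

Let phiZ_delta s i j : phi (s *: E i j) = psi (s *: E j i).
Proof. by rewrite phiT linearZ /= trmx_delta. Qed.

Lemma hom_proj_tr : beta = p o * psi (E l o) * psi (E o l).
Proof. by rewrite hom_projE !phi_delta. Qed.

Lemma hom_proj_sum : alpha + beta = p o.
Proof.
rewrite hom_proj_tr hom_projE -!mulrA -mulrDr.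
have := psi_off_mul F2 psiP 1 1 ol; rewrite !scale1r mulr1 !scale1r => ->.
by rewrite mulrDr (unit_idem F2 psiP) (unit_orth F2 psiP) // addr0.
Qed.

Lemma hom_proj_orth : alpha * beta = 0.
Proof.
by rewrite hom_proj_tr !mulrA (hom_projP F2 psiP ol) (hom_proj_lo F2 psiP ol)
  mul0r.
Qed.

Let row_delta i a b : a != o -> E o i a b = 0.
Proof. by move=> ao; rewrite deltaE (negbTE ao). Qed.

Let row_delta_mul i X a b : a != o -> (E o i *m X) a b = 0.
Proof. by move=> ao; rewrite mul_delta_mxE (negbTE ao) mul0r. Qed.

(** From E_oi X E_jo = X_ij E_oo; these are the blocks of the amplification. *)
Lemma hom_proj_corner i j X :
  alpha * psi (E o i) * psi X * psi (E j o) = alpha * d (X i j).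
Proof.
rewrite (hom_proj_mul F2 psiP ol _ (row_delta i)).
rewrite (hom_proj_mul F2 psiP ol _ (row_delta_mul i X)).
by congr (_ * psi _); entries; eq_cases; ring.
Qed.

(** From E_oi X E_oj = X_io E_oj, whose image has no (o,o) corner unless j = o, where
    [alpha * beta = 0] applies. These are the blocks between the two amplifications. *)
Lemma hom_proj_cross i j X :
  alpha * psi (E o i) * psi X * psi (E o j) * beta = 0.
Proof.
rewrite (hom_proj_mul F2 psiP ol _ (row_delta i)).
rewrite (hom_proj_mul F2 psiP ol _ (row_delta_mul i X)).
have -> : E o i *m X *m E o j = X i o *: E o j by entries; eq_cases; ring.
have [->|jo] := eqVneq j o.
  by rewrite -hom_proj_comm // -mulrA hom_proj_orth mulr0.
have oj : o != j by rewrite eq_sym.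
rewrite -(hom_projP F2 psiP ol) -(P_hom_proj F2 phiP o l) phi_delta.
rewrite -[_ * p o * _]mulrA mulrA -[alpha * _ * _]mulrA.
by rewrite (off_diag0 F2 psiP o oj (offZ _ (off_delta F oj))) mulr0 mul0r.
Qed.

(** As [beta] kills psi(E_oi), here [alpha] may be replaced by [p o]. *)
Lemma hom_proj_partial i : i != o ->
  psi (E i o) * alpha * psi (E o i) = p i * (psi (E i o) * psi (E o i)).
Proof.
move=> io; have oi : o != i by rewrite eq_sym.
have b0 : beta * psi (E o i) = 0.
  by have := hom_proj_col F2 phiP ol 1 io; rewrite phiZ_delta scale1r.
rewrite -[LHS]mulrA; have -> : alpha * psi (E o i) = p o * psi (E o i).
  by rewrite -hom_proj_sum mulrDl b0 addr0.
rewrite !mulrA; congr (_ * _).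
by rewrite (off_comm F2 psiP io (off_delta F io)).
Qed.

End OneSided.

(* Transposition exchanges the roles of alpha and beta. *)
Section TwoSided.

Variables psi phi : 'M[F]_n -> A.
Hypothesis psiP : preJordan psi.
Hypothesis phiT : forall X, phi X = psi X^T.

Notation alpha := (hom_proj psi o l).
Notation beta := (hom_proj phi o l).

Let phi_delta i j : phi (E i j) = psi (E j i).
Proof. by rewrite phiT trmx_delta. Qed.

Let psiT X : psi X = phi X^T. Proof. by rewrite phiT trmxK. Qed.

Let phiP : preJordan phi := preJordan_tr phiT psiP.

(** The i-th term is [p i]: for i = o it is [alpha + beta], otherwise [hom_proj_partial] turns it
    into p_i (p_i + p_o). *)
Lemma hom_proj_resolution :
  \sum_i (psi (E i o) * alpha * psi (E o i) + psi (E o i) * beta * psi (E i o))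
    =
  psi 1%:M.
Proof.
rewrite -(sum_p F2 psiP); apply: eq_bigr => i _.
have [->|io] := eqVneq i o.
  rewrite (P_hom_proj F2 psiP o l) (hom_projP F2 psiP ol) -phi_delta.
  rewrite (P_hom_proj F2 phiP o l) (hom_projP F2 phiP ol).
  by rewrite phi_delta (hom_proj_sum psiP phiT).
have := hom_proj_partial phiP psiT io; rewrite !phi_delta => ->.
rewrite (hom_proj_partial psiP phiT io) -mulrDr.
have := psi_off_mul F2 psiP 1 1 io; rewrite !scale1r mulr1 !scale1r => ->.
by rewrite mulrDr (unit_idem F2 psiP) (unit_orth F2 psiP) // addr0.
Qed.

End TwoSided.

End Splitting.

(** * Block matrices *)

(** In a rank factorisation p = C B, C is left invertible and B right invertible, so they cancel
    from C (B C) B = C B. *)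
Lemma idem_factor (K : fieldType) k (p : 'M[K]_k) : p *m p = p ->
  exists (r : nat) (B : 'M[K]_(r, k)) (C : 'M[K]_(k, r)),
    C *m B = p /\ B *m C = 1%:M.
Proof.
move=> pp; exists (\rank p), (row_base p), (col_base p).
have CB := mulmx_base p; split=> //.
have CK := mulVpmx (col_base_full p); have BK := mulmxVp (row_base_free p).
move: (row_base p) (col_base p) (pinvmx _) (pinvmx _) CB CK BK => B C B' C' CB
  CK BK.
have e1 : C' *m (C *m (B *m C) *m B) *m B' = B *m C.
  by rewrite !mulmxA CK mul1mx -[_ *m B *m B']mulmxA BK mulmx1.
have e2 : C' *m (C *m B) *m B' = 1%:M by rewrite mulmxA CK mul1mx BK.
have h : C *m (B *m C) *m B = C *m B by rewrite mulmxA CB -mulmxA CB pp.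
by rewrite -e1 h e2.
Qed.

Lemma rmorphism_exists (R S : pzRingType) (f : R -> S) :
  (forall x y, f (x + y) = f x + f y) -> (forall x y, f (x * y) = f x * f y) ->
  f 1 = 1 -> exists g : {rmorphism R -> S}, g =1 f.
Proof.
move=> fD fM f1.
have f0 : f 0 = 0 by apply: (addrI (f 0)); rewrite -fD !addr0.
have fB : zmod_morphism f.
  move=> x y; apply: (addIr (f y)); rewrite -fD !subrK //.
pose fa := GRing.isZmodMorphism.Build R S f fB.
have fmon : monoid_morphism f by split.
pose fm := GRing.isMonoidMorphism.Build R S f fmon.
pose g : {rmorphism R -> S} := HB.pack f fa fm.
by exists g.
Qed.

Section BlockAlgebra.

Variable K : fieldType.

Lemma dsum_mul p q (A C : 'M[K]_p) (B D : 'M[K]_q) :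
  dsum_mx A B *m dsum_mx C D = dsum_mx (A *m C) (B *m D).
Proof. by rewrite /dsum_mx mulmx_block !mulmx0 !mul0mx !addr0 !add0r. Qed.

Lemma dsumD p q (A C : 'M[K]_p) (B D : 'M[K]_q) :
  dsum_mx A B + dsum_mx C D = dsum_mx (A + C) (B + D).
Proof. by rewrite /dsum_mx add_block_mx !addr0. Qed.

Lemma dsum_inj p q (A C : 'M[K]_p) (B D : 'M[K]_q) :
  dsum_mx A B = dsum_mx C D -> A = C /\ B = D.
Proof. by move/eq_block_mx => [-> _ _ ->]. Qed.

Lemma dsum1 p q : dsum_mx (1%:M : 'M[K]_p) (1%:M : 'M[K]_q) = 1%:M.
Proof. by rewrite /dsum_mx -scalar_mx_block. Qed.

Lemma dsum0 p q : dsum_mx (0 : 'M[K]_p) (0 : 'M[K]_q) = 0.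
Proof. by rewrite /dsum_mx block_mx0. Qed.

Section Cast.

Variables (m m' : nat) (h : m = m').

Lemma castmx_mul (A B : 'M[K]_m) :
  castmx (h, h) A *m castmx (h, h) B = castmx (h, h) (A *m B).
Proof. by case: _ / h. Qed.

Lemma castmxD (A B : 'M[K]_m) :
  castmx (h, h) A + castmx (h, h) B = castmx (h, h) (A + B).
Proof. by case: _ / h. Qed.

Lemma castmx1 : castmx (h, h) (1%:M : 'M[K]_m) = 1%:M.
Proof. by case: _ / h. Qed.

Lemma castmx0 : castmx (h, h) (0 : 'M[K]_m) = 0.
Proof. by case: _ / h. Qed.

Lemma castmx_injective (A B : 'M[K]_m) :
  castmx (h, h) A = castmx (h, h) B -> A = B.
Proof. by case: _ / h. Qed.

Lemma castmx_compress k (P : 'M[K]_(m, k)) (M : 'M[K]_k) (Q : 'M[K]_(k, m)) :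
  castmx (h, erefl) P *m M *m castmx (erefl, h) Q = castmx (h, h) (P *m M *m Q).
Proof. by case: _ / h. Qed.

Lemma castmx_expand k (P : 'M[K]_(m, k)) (Q : 'M[K]_(k, m)) :
  castmx (erefl, h) Q *m castmx (h, erefl) P = Q *m P.
Proof. by case: _ / h. Qed.

End Cast.

End BlockAlgebra.

(** * Amplifications are unital ring homomorphisms *)

Section Amplification.

Variables (F K : fieldType) (n r : nat) (omega : {rmorphism F -> 'M[K]_r}).

Lemma amplificationD (X Y : 'M[F]_n) :
  amplification omega (X + Y) = amplification omega X + amplification omega Y.
Proof.
rewrite /amplification castmxD -mxblockD; congr castmx.
by apply: eq_mxblock => i j; rewrite addmxE rmorphD.
Qed.

Lemma amplificationM (X Y : 'M[F]_n) :
  amplification omega (X *m Y) = amplification omega X *m amplification omega Y.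
Proof.
rewrite /amplification castmx_mul mul_mxblock; congr castmx.
apply: eq_mxblock => i j; rewrite mxE rmorph_sum.
by apply: eq_bigr => k _; rewrite rmorphM.
Qed.

Lemma amplification1 : amplification omega (1%:M : 'M[F]_n) = 1%:M.
Proof.
rewrite /amplification -[RHS](castmx1 _ (sum_const_ord n r)) -mxdiagZ;
  congr castmx.
apply: eq_mxblock => i j; rewrite one_mxE; case: eqP => _;
  last by rewrite rmorph0.
by rewrite conform_mx_id rmorph1.
Qed.

Lemma amplification0 : amplification omega (0 : 'M[F]_n) = 0.
Proof.
by apply: (addrI (amplification omega (0 : 'M[F]_n)));
  rewrite -amplificationD !addr0.
Qed.

End Amplification.

Lemma jordan_mul_double (K : fieldType) k (X Y : 'M[K]_k) : 2%:R != 0 :> K ->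
  jordan_mul X Y + jordan_mul X Y = X *m Y + Y *m X.
Proof. by move=> K2; rewrite scale_halfD. Qed.

Lemma jordan_mulP (K : fieldType) k (X Y Z : 'M[K]_k) : 2%:R != 0 :> K ->
  Z + Z = X *m Y + Y *m X -> Z = jordan_mul X Y.
Proof. by move=> K2 h; rewrite /jordan_mul -h scalerDr scale_halfD. Qed.

Lemma jordan_mul0 (K : fieldType) k (X : 'M[K]_k) : jordan_mul 0 X = 0.
Proof. by rewrite /jordan_mul mul0mx mulmx0 addr0 scaler0. Qed.

Lemma jordan_mul1 (K : fieldType) k (X : 'M[K]_k) : 2%:R != 0 :> K ->
  jordan_mul 1%:M X = X.
Proof. by move=> K2; rewrite /jordan_mul mul1mx mulmx1 scalerDr scale_halfD.
  Qed.

Lemma matrix_2torsion_free (K : fieldType) k : 2%:R != 0 :> K ->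
  forall X : 'M[K]_k, X + X = 0 -> X = 0.
Proof.
move=> K2 X h; rewrite -(scale_halfD K2 X).
by rewrite -scalerDr h scaler0.
Qed.

(** Multiplicativity is [hom_proj_diagM], because the inner factor C B is the projection, which
    commutes with each psi(s E_oo). *)
Lemma compress_rmorphism (F K : fieldType) n k r (psi : 'M[F]_n -> 'M[K]_k)
    (o l : 'I_n) (B : 'M[K]_(r, k)) (C : 'M[K]_(k, r)) :
  2%:R != 0 :> F -> preJordan psi -> o != l ->
  C *m B = hom_proj psi o l -> B *m C = 1%:M ->
  exists omega : {rmorphism F -> 'M[K]_r},
    forall s, omega s = B *m psi (s *: delta_mx o o) *m C.
Proof.
move=> F2 psiP ol CB BC; pose w s := B *m psi (s *: delta_mx o o) *m C.
have n2 : (1 < n)%N by case: n o l ol {psi psiP CB w} => [[]//|[|//]] x y;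
  rewrite !ord1.
have BE : B = B *m hom_proj psi o l by rewrite -CB mulmxA BC mul1mx.
have CE : C = hom_proj psi o l *m C by rewrite -CB -mulmxA BC mulmx1.
have [||| g gE] := @rmorphism_exists F 'M[K]_r w; last by exists g.
- by move=> x y; rewrite /w scalerDl (psiD F2 psiP n2) mulmxDr mulmxDl.
- move=> x y; have := hom_proj_diagM F2 psiP ol x y; rewrite -mulmxE => h.
  have hc := hom_proj_comm F2 psiP ol x; rewrite -mulmxE in hc.
  rewrite /w {1}BE -[B *m _ *m _]mulmxA -h -mulmxE !mulmxA -[_ *m C *m B]mulmxA
    CB.
  by rewrite -[B *m _ *m hom_proj _ _ _]mulmxA hc !mulmxA.
- rewrite /w scale1r {1}BE -[B *m _ *m _]mulmxA.
  by have := hom_projP F2 psiP ol; rewrite -mulmxE => ->; rewrite -BE BC.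
Qed.

(** Mutually inverse rectangular matrices are square; [S] is [P] with its row count recast. *)
Lemma similarity_of_compression (K : fieldType) N k (P : 'M[K]_(N, k)) (Q :
  'M[K]_(k, N)) :
  P *m Q = 1%:M -> Q *m P = 1%:M ->
  exists (hd : N = k) (S : 'M[K]_k), S \in unitmx /\
    forall M, S *m M *m invmx S = castmx (hd, hd) (P *m M *m Q).
Proof.
move=> PQ QP; have hd : N = k.
  by apply/eqP; rewrite eqn_leq (mulmx1_min PQ) (mulmx1_min QP).
exists hd, (castmx (hd, erefl) P).
have h : castmx (hd, erefl) P *m castmx (erefl, hd) Q = 1%:M.
  by rewrite -[castmx _ P]mulmx1 castmx_compress mulmx1 PQ castmx1.
have [Su _] := mulmx1_unit h; split=> // M.
have -> : invmx (castmx (hd, erefl) P) = castmx (erefl, hd) Q.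
  by rewrite -[RHS](mulKmx Su) h mulmx1.
by rewrite castmx_compress.
Qed.

Lemma castmx_mxcol_mul (K : fieldType) (p m k : nat) (p_ : 'I_p -> nat)
    (h : (\sum_i p_ i)%N = m) (B : forall i, 'M[K]_(p_ i, k)) (M : 'M[K]_k) :
  (forall i, B i *m M = B i) ->
  castmx (h, erefl k) (\mxcol_i B i) *m M = castmx (h, erefl k) (\mxcol_i B i).
Proof.
move=> BM; case: _ / h; rewrite !castmx_id mxcol_mul.
by apply: eq_mxcol => i; rewrite BM.
Qed.

Lemma mul_castmx_mxrow (K : fieldType) (p m k : nat) (p_ : 'I_p -> nat)
    (h : (\sum_i p_ i)%N = m) (B : forall i, 'M[K]_(k, p_ i)) (M : 'M[K]_k) :
  (forall i, M *m B i = B i) ->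
  M *m castmx (erefl k, h) (\mxrow_i B i) = castmx (erefl k, h) (\mxrow_i B i).
Proof.
move=> BM; case: _ / h; rewrite !castmx_id mul_mxrow.
by apply: eq_mxrow => i; rewrite BM.
Qed.

Lemma castmx_block_compress (K : fieldType) (p q m m' k : nat) (p_ : 'I_p ->
  nat)
    (q_ : 'I_q -> nat) (h : (\sum_i p_ i)%N = m) (h' : (\sum_i q_ i)%N = m')
    (B : forall i, 'M[K]_(p_ i, k)) (C : forall i, 'M[K]_(k, q_ i)) (M :
      'M[K]_k) :
  castmx (h, erefl k) (\mxcol_i B i) *m M *m castmx (erefl k, h') (\mxrow_i C
    i) =
  castmx (h, h') (\mxblock_(i, j) (B i *m M *m C j)).
Proof.
case: _ / h; case: _ / h'; rewrite !castmx_id mxcol_mul mul_mxcol_mxrow.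
exact: eq_mxblock.
Qed.

(** * Assembling the normal form *)

Section Assembly.

Variables (F K : fieldType) (n k : nat) (f : 'M[F]_n -> 'M[K]_k).
Hypothesis F2 : 2%:R != 0 :> F.
Hypothesis K2 : 2%:R != 0 :> K.
Hypothesis n2 : (1 < n)%N.
Hypothesis fJ : jordan_multiplicative f.

Notation E := (@delta_mx F n n).

Let A2 := matrix_2torsion_free (k := k) K2.

(** The orthogonal idempotents [q] and [T] produce the summands I_s and 0_t. *)
Let q := f 0.
Let T := 1%:M - f 1%:M.
Let psi X := f X - q.
Let phi X := psi X^T.

Let fD X Y : f X * f Y + f Y * f X = f (jordan_mul X Y) + f (jordan_mul X Y).
Proof. by rewrite fJ jordan_mul_double. Qed.

Let qq : q * q = q.
Proof. by apply: (addrr_inj A2); rewrite fD jordan_mul0. Qed.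

Let qf X : q * f X = q /\ f X * q = q.
Proof. by apply: (idem_jordan_abs A2) => //; rewrite fD jordan_mul0. Qed.

Let ff1 : f 1%:M * f 1%:M = f 1%:M.
Proof. by apply: (addrr_inj A2); rewrite fD jordan_mul1. Qed.

Let f1f X : f 1%:M * f X = f X /\ f X * f 1%:M = f X.
Proof. by apply: (idem_jordan1 A2) => //; rewrite fD jordan_mul1. Qed.

Let psi_mul X Y : psi X * psi Y = f X * f Y - q.
Proof.
by rewrite /psi mulrBr !mulrBl (qf X).2 (qf Y).1 qq subrr subr0.
Qed.

Let psiP : preJordan psi.
Proof.
split; [exact: A2 | by rewrite /psi subrr |].
by move=> X Y; rewrite !psi_mul addrACA fD mulr2n /psi addrACA.
Qed.

Let phiP : preJordan phi.
Proof. exact: (preJordan_tr (fun X => erefl) psiP). Qed.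

Let qpsi X : q * psi X = 0.
Proof. by rewrite /psi mulrBr (qf X).1 qq subrr. Qed.
Let psiq X : psi X * q = 0.
Proof. by rewrite /psi mulrBl (qf X).2 qq subrr. Qed.
Let TT : T * T = T.
Proof. by rewrite /T mulrBr mulr1 mulrBl mul1r ff1 subrr subr0. Qed.
Let Tf X : T * f X = 0.
Proof. by rewrite /T mulrBl mul1r (f1f X).1 subrr. Qed.
Let fT X : f X * T = 0.
Proof. by rewrite /T mulrBr mulr1 (f1f X).2 subrr. Qed.
Let Tpsi X : T * psi X = 0.
Proof. by rewrite /psi mulrBr !Tf subrr. Qed.
Let psiT X : psi X * T = 0.
Proof. by rewrite /psi mulrBl !fT subrr. Qed.

Lemma jordan_form_exists :
  exists (s r u t : nat) (hd : (s + n * r + n * u + t)%N = k) (S : 'M[K]_k)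
         (omega : {rmorphism F -> 'M[K]_r})
         (sigma : {rmorphism F -> 'M[K]_u}),
    S \in unitmx /\ jordan_form hd S omega sigma f.
Proof.
pose o := Ordinal (ltnW n2); pose l := Ordinal n2.
have ol : o != l by [].
have phiT X : phi X = psi X^T by [].
have psi_phi X : psi X = phi X^T by rewrite /phi trmxK.
set a := hom_proj psi o l; set b := hom_proj phi o l.
have ab : a * b = 0 by apply: hom_proj_orth.
have ba : b * a = 0 by apply: (hom_proj_orth F2 ol phiP).
have abP : a + b = psi (E o o) by apply: hom_proj_sum.
have aa : a * a = a.
  by have := hom_projP F2 psiP ol; rewrite -/a -abP mulrDr ab addr0.
have bb : b * b = b.
  have := hom_projP F2 phiP ol; rewrite -/b -[phi _](_ : psi (E o o) = _).
    by rewrite -abP mulrDr ba add0r.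
  by rewrite /phi trmx_delta.
have [r [B1 [C1 [CB1 BC1]]]] := idem_factor aa.
have [u [B2 [C2 [CB2 BC2]]]] := idem_factor bb.
have [s [B0 [C0 [CB0 BC0]]]] := idem_factor qq.
have [t [B3 [C3 [CB3 BC3]]]] := idem_factor TT.
have [omega omegaE] := compress_rmorphism F2 psiP ol CB1 BC1.
have [sigma sigmaE] := compress_rmorphism F2 phiP ol CB2 BC2.
pose e := psi 1%:M.
have B0q : B0 *m q = B0 by rewrite -CB0 mulmxA BC0 mul1mx.
have C0q : q *m C0 = C0 by rewrite -CB0 -mulmxA BC0 mulmx1.
have B3T : B3 *m T = B3 by rewrite -CB3 mulmxA BC3 mul1mx.
have C3T : T *m C3 = C3 by rewrite -CB3 -mulmxA BC3 mulmx1.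
have B1a : B1 *m a = B1 by rewrite -CB1 mulmxA BC1 mul1mx.
have C1a : a *m C1 = C1 by rewrite -CB1 -mulmxA BC1 mulmx1.
have B2b : B2 *m b = B2 by rewrite -CB2 mulmxA BC2 mul1mx.
have C2b : b *m C2 = C2 by rewrite -CB2 -mulmxA BC2 mulmx1.
(* M 0 Y = f Y and M 1 1 = 1. *)
pose M c Y := q + psi Y + c *: T.
have eX X : e *m psi X = psi X by apply: (unit_mull F2 psiP).
have Xe X : psi X *m e = psi X by apply: (unit_mulr F2 psiP).
have ZT c X : X * (c *: T) = c *: (X * T) by rewrite -!mulmxE -scalemxAr.
have TZ c X : c *: T * X = c *: (T * X) by rewrite -!mulmxE -scalemxAl.
have qT : q * T = 0 by apply: fT.
have Tq : T * q = 0 by apply: Tf.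
have qM c Y : q *m M c Y = q.
  by rewrite mulmxE /M mulrDr mulrDr qq qpsi ZT qT scaler0 !addr0.
have eM c Y : e *m M c Y = psi Y.
  by rewrite mulmxE /M mulrDr mulrDr psiq ZT psiT scaler0 addr0 add0r -mulmxE
    eX.
have TM c Y : T *m M c Y = c *: T.
  by rewrite mulmxE /M mulrDr mulrDr Tq Tpsi ZT TT !add0r.
(* [L1] and [R1] transport the image of [a] to all n indices; [L2] and [R2] do this for [b], with
   the matrix units transposed. *)
pose L1 := castmx (sum_const_ord n r, erefl k) (\mxcol_(i < n) (B1 *m psi (E o
  i))).
pose R1 := castmx (erefl k, sum_const_ord n r) (\mxrow_(i < n) (psi (E i o) *m
  C1)).
pose L2 := castmx (sum_const_ord n u, erefl k) (\mxcol_(i < n) (B2 *m psi (E i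
  o))).
pose R2 := castmx (erefl k, sum_const_ord n u) (\mxrow_(i < n) (psi (E o i) *m
  C2)).
have L1e : L1 *m e = L1 by apply: castmx_mxcol_mul => i; rewrite -mulmxA Xe.
have L2e : L2 *m e = L2 by apply: castmx_mxcol_mul => i; rewrite -mulmxA Xe.
have R1e : e *m R1 = R1 by apply: mul_castmx_mxrow => i; rewrite mulmxA eX.
have R2e : e *m R2 = R2 by apply: mul_castmx_mxrow => i; rewrite mulmxA eX.
have z1 Y : L1 *m psi Y *m R1 = amplification omega Y.
  rewrite castmx_block_compress; congr castmx; apply: eq_mxblock => i j.
  have := hom_proj_corner F2 ol psiP i j Y; rewrite -/a -mulmxE => h.
  by rewrite omegaE -B1a -[_ *m a *m psi (_ *: _)]mulmxA -h !mulmxA.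
have phi_delta i j : phi (E i j) = psi (E j i) by rewrite phiT trmx_delta.
have z2 Y : L2 *m psi Y *m R2 = amplification sigma Y^T.
  rewrite castmx_block_compress; congr castmx; apply: eq_mxblock => i j.
  have := hom_proj_corner F2 ol phiP i j Y^T;
    rewrite -/b !phi_delta -psi_phi -mulmxE => h.
  by rewrite sigmaE -B2b -[_ *m b *m phi (_ *: _)]mulmxA -h !mulmxA.
have z12 Y : L1 *m psi Y *m R2 = 0.
  rewrite castmx_block_compress -[RHS](castmx_const (sum_const_ord n r,
    sum_const_ord n u)).
  congr castmx; rewrite -[RHS]mxblock0; apply: eq_mxblock => i j.
  have := hom_proj_cross F2 ol psiP phiT i j Y; rewrite -/a -/b -mulmxE => h.
  rewrite -B1a -C2b -[RHS](mul0mx _ C2) -[in RHS](mulmx0 _ B1) -h.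
  by rewrite !mulmxA.
have z21 Y : L2 *m psi Y *m R1 = 0.
  rewrite castmx_block_compress -[RHS](castmx_const (sum_const_ord n u,
    sum_const_ord n r)).
  congr castmx; rewrite -[RHS]mxblock0; apply: eq_mxblock => i j.
  have := hom_proj_cross F2 ol phiP psi_phi i j Y^T.
  rewrite -/a -/b !phi_delta -psi_phi -mulmxE => h.
  rewrite -B2b -C1a -[RHS](mul0mx _ C1) -[in RHS](mulmx0 _ B2) -h.
  by rewrite !mulmxA.
have orth m m' (B : 'M[K]_(m, k)) (C : 'M[K]_(k, m')) (x y : 'M[K]_k) :
    B *m x = B -> y *m C = C -> x *m y = 0 -> B *m C = 0.
  by move=> <- <- xy; rewrite mulmxA -[B *m x *m y]mulmxA xy mulmx0 mul0mx.
have B0R1 : B0 *m R1 = 0 by apply: (orth _ _ _ _ q e) => //; apply: qpsi.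
have B0R2 : B0 *m R2 = 0 by apply: (orth _ _ _ _ q e) => //; apply: qpsi.
have B0C3 : B0 *m C3 = 0 by apply: (orth _ _ _ _ q T).
have B3C0 : B3 *m C0 = 0 by apply: (orth _ _ _ _ T q).
have B3R1 : B3 *m R1 = 0 by apply: (orth _ _ _ _ T e) => //; apply: Tpsi.
have B3R2 : B3 *m R2 = 0 by apply: (orth _ _ _ _ T e) => //; apply: Tpsi.
have psiC0 Y : psi Y *m C0 = 0 by rewrite -C0q mulmxA [psi Y *m q]psiq mul0mx.
have psiC3 Y : psi Y *m C3 = 0 by rewrite -C3T mulmxA [psi Y *m T]psiT mul0mx.
pose P := col_mx (col_mx (col_mx B0 L1) L2) B3.
pose Q := row_mx (row_mx (row_mx C0 R1) R2) C3.
(* One computation serves twice: c = 1 at Y = 1 gives P Q = 1, and c = 0 gives the normal form. *)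
have key c Y : P *m M c Y *m Q =
    dsum_mx (dsum_mx (dsum_mx (1%:M : 'M[K]_s) (amplification omega Y))
      (amplification sigma Y^T)) (c%:M : 'M[K]_t).
  have B0M : B0 *m M c Y = B0 by rewrite -B0q -mulmxA qM.
  have L1M : L1 *m M c Y = L1 *m psi Y by rewrite -{1}L1e -mulmxA eM.
  have L2M : L2 *m M c Y = L2 *m psi Y by rewrite -{1}L2e -mulmxA eM.
  have B3M : B3 *m M c Y = c *: B3 by rewrite -{1}B3T -mulmxA TM -scalemxAr B3T.
  have PM : P *m M c Y = col_mx (col_mx (col_mx B0 (L1 *m psi Y)) (L2 *m psi
    Y)) (c *: B3).
    by rewrite !mul_col_mx B0M L1M L2M B3M.
  rewrite PM /Q /dsum_mx !mul_col_row.
  rewrite !mul_col_mx !mul_mx_row -!scalemxAl -!(mulmxA _ (psi Y)) !psiC0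
    !psiC3 !mulmxA.
  by rewrite z1 z2 z12 z21 BC0 BC3 B0R1 B0R2 B0C3 B3C0 B3R1 B3R2 !scaler0
    !mulmx0
    !col_mx0 !row_mx0 scalemx1.
have one_sum : q + e + T = 1%:M
  by rewrite /e /psi /T addrC [q + _]addrC subrK subrK.
(* The product is q plus the sum in [hom_proj_resolution], which is e, plus T. *)
have QP : Q *m P = 1%:M.
  rewrite /Q /P !mul_row_col CB0 CB3 !castmx_expand !mul_mxrow_mxcol.
  rewrite -one_sum -[in LHS](addrA q); congr (_ + _ + _).
  have := hom_proj_resolution F2 ol psiP phiT;
    rewrite big_split /= -/a -/b -mulmxE -/e => <-.
  by congr (_ + _); apply: eq_bigr => i _; rewrite -?CB1 -?CB2 !mulmxA.
have PQ : P *m Q = 1%:M.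
  have := key 1 1%:M; rewrite /M scale1r one_sum mulmx1 trmx1 !amplification1.
  by rewrite !dsum1.
have [hd [S [Su SE]]] := similarity_of_compression PQ QP.
exists s, r, u, t, hd, S, omega, sigma; split=> // X.
rewrite SE; congr castmx.
have := key 0 X; rewrite /M scale0r addr0 /psi addrC subrK => ->.
by rewrite raddf0.
Qed.

End Assembly.

Lemma scalar_mx1_eq0 (K : fieldType) s : (1%:M : 'M[K]_s) = 0 <-> s = 0%N.
Proof.
split=> [|->]; last by rewrite !thinmx0.
case: s => // s /matrixP/(_ ord0 ord0)/eqP.
by rewrite one_mxE zeromxE eqxx oner_eq0.
Qed.

(** * Maps in normal form *)

Section Conjugation.

Variables (K : fieldType) (k : nat) (S : 'M[K]_k).
Hypothesis Su : S \in unitmx.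

Lemma conj_mx_inj (A B : 'M[K]_k) : S *m A *m invmx S = S *m B *m invmx S ->
  A = B.
Proof.
move/(congr1 (fun M => invmx S *m (M *m S))).
by rewrite !(mulmxKV Su) !(mulKmx Su).
Qed.

Lemma conj_mxM (A B : 'M[K]_k) :
  S *m (A *m B) *m invmx S = S *m A *m invmx S *m (S *m B *m invmx S).
Proof. by rewrite !mulmxA (mulmxKV Su). Qed.

Lemma conj_mxD (A B : 'M[K]_k) :
  S *m (A + B) *m invmx S = S *m A *m invmx S + S *m B *m invmx S.
Proof. by rewrite mulmxDr mulmxDl. Qed.

Lemma conj_mx0 : S *m 0 *m invmx S = 0. Proof. by rewrite mulmx0 mul0mx. Qed.

Lemma conj_mx1 : S *m 1%:M *m invmx S = 1%:M. Proof.
  by rewrite mulmx1 mulmxV. Qed.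

End Conjugation.

Section Converse.

Variables (F K : fieldType) (n k : nat) (f : 'M[F]_n -> 'M[K]_k).
Hypothesis F2 : 2%:R != 0 :> F.
Hypothesis K2 : 2%:R != 0 :> K.
Variables (s r u t : nat) (hd : (s + n * r + n * u + t)%N = k) (S : 'M[K]_k)
  (omega : {rmorphism F -> 'M[K]_r}) (sigma : {rmorphism F -> 'M[K]_u}).
Hypothesis Su : S \in unitmx.
Hypothesis formf : jordan_form hd S omega sigma f.

(** After doubling, each summand respects X Y + Y X; transposition only swaps the two terms. *)
Lemma jordan_form_multiplicative : jordan_multiplicative f.
Proof.
move=> X Y; apply: (jordan_mulP K2); apply: (conj_mx_inj Su).
rewrite !conj_mxD !conj_mxM // !formf !castmx_mul !castmxD; congr castmx.
rewrite !dsum_mul !dsumD mulmx1 !mulmx0 -!amplificationM -!amplificationD.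
by rewrite trmx_jordan_mul !jordan_mul_double.
Qed.

Lemma jordan_form0 : f 0 = 0 <-> s = 0%N.
Proof.
have h : f 0 = 0 <-> (1%:M : 'M[K]_s) = 0.
  split=> e.
    have := formf 0; rewrite e conj_mx0 trmx0 !amplification0 -(castmx0 _ hd).
    by move/castmx_injective; rewrite -!dsum0 => /dsum_inj[] /dsum_inj[]
      /dsum_inj[].
  apply: (conj_mx_inj Su).
  by rewrite formf e trmx0 !amplification0 !dsum0 castmx0 conj_mx0.
by rewrite h; apply: scalar_mx1_eq0.
Qed.

Lemma jordan_form1 : f 1%:M = 1%:M <-> t = 0%N.
Proof.
have h : f 1%:M = 1%:M <-> (1%:M : 'M[K]_t) = 0.
  split=> e.
    have := formf 1%:M; rewrite e conj_mx1 // trmx1 !amplification1 !dsum1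
      -(castmx1 _ hd).
    by move/castmx_injective; rewrite -dsum1 => /dsum_inj[].
  apply: (conj_mx_inj Su).
  by rewrite formf -e trmx1 !amplification1 !dsum1 castmx1 conj_mx1.
by rewrite h; apply: scalar_mx1_eq0.
Qed.

End Converse.

Theorem theorem1p3 (F K : fieldType) (n k : nat)
    (charF : 2%N \notin [pchar F]) (charK : 2%N \notin [pchar K])
    (hn : (2 <= n)%N) (hk : (1 <= k)%N) :
  (forall phi : 'M[F]_n -> 'M[K]_k,
    jordan_multiplicative phi ->
    exists (s r u t : nat) (hd : (s + n * r + n * u + t)%N = k) (S : 'M[K]_k)
           (omega : {rmorphism F -> 'M[K]_r})
           (sigma : {rmorphism F -> 'M[K]_u}),
      S \in unitmx /\ jordan_form hd S omega sigma phi) /\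
  (forall (phi : 'M[F]_n -> 'M[K]_k)
          (s r u t : nat) (hd : (s + n * r + n * u + t)%N = k) (S : 'M[K]_k)
          (omega : {rmorphism F -> 'M[K]_r})
          (sigma : {rmorphism F -> 'M[K]_u}),
    S \in unitmx -> jordan_form hd S omega sigma phi ->
    [/\ jordan_multiplicative phi,
        phi 0 = 0 <-> s = 0%N &
        phi 1%:M = 1%:M <-> t = 0%N]).
Proof.
have F2 : 2%:R != 0 :> F by move: charF; rewrite inE /=.
have K2 : 2%:R != 0 :> K by move: charK; rewrite inE /=.
split=> [phi phiJ | phi s r u t hd S omega sigma Su form].
  exact: jordan_form_exists.
split; first exact: (jordan_form_multiplicative F2 K2 Su form).
  exact: (jordan_form0 Su form).
exact: (jordan_form1 Su form).
Qed.
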